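(* Let $p\ge 3$ and let $\Phi:(0,\infty)\to(0,\infty)$ be positive and monotone non-decreasing, with $\int_0^w t^{-1}\Phi(t)\,\mathrm{d}t<\infty$ for all $w>0$. For a constant $C\ge 1/(p-2)$ define $$\phi(w)=p-2-\frac{1}{\int_0^w t^{-1}\Phi(t)\,\mathrm{d}t+C},\qquad w\ge 0 .$$ If $R(0,\hat\theta_{\mathrm{JS}})\ge R(0,\hat\theta_\phi)$, then the estimator $\hat\theta_\phi(X)=\bigl(1-\phi(\|X\|^2)/\|X\|^2\bigr)X$ dominates the James--Stein estimator, i.e. $R(\theta,\hat\theta_\phi)\le R(\theta,\hat\theta_{\mathrm{JS}})$ for all $\theta\in\mathbb{R}^p$.
   Context: Let $X\sim\mathcal{N}_p(\theta,I_p)$ with $\theta\in\mathbb{R}^p$, $p\ge 3$. The risk of an estimator $\hat\theta$ is $R(\theta,\hat\theta)=\mathrm{E}_\theta[\|\hat\theta(X)-\theta\|^2]$. The James--Stein estimator is $\hat\theta_{\mathrm{JS}}(X)=\bigl(1-(p-2)/\|X\|^2\bigr)X$. *)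

(* Defs.v *)
From HB Require Import structures.
From mathcomp Require Import all_boot all_order all_algebra.
From mathcomp Require Import all_classical all_reals all_analysis.
Set Implicit Arguments. Unset Strict Implicit. Unset Printing Implicit Defensive.
Import Order.TTheory GRing.Theory Num.Theory.
Local Open Scope classical_set_scope.
Local Open Scope ring_scope.

Section Defs.
Variables (R : realType) (p : nat).

Definition sqnorm (x : 'rV[R]_p) : R := \sum_(i < p) x 0 i ^+ 2.

Definition setcoord (x : 'rV[R]_p) (i : 'I_p) (t : R) : 'rV[R]_p :=
  \row_(j < p) (if j == i then t else x 0 j).

Definition gauss_step (theta : 'rV[R]_p) (i : 'I_p)
  (G : 'rV[R]_p -> \bar R) : 'rV[R]_p -> \bar R :=
  fun x => (\int[lebesgue_measure]_t
              (G (setcoord x i t) * (normal_pdf (theta 0 i) 1 t)%:E))%E.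

(* E_theta[F(X)] for X ~ N_p(theta, I_p) and F >= 0 : iterated integral
   against the product of the coordinate densities (Tonelli) *)
Definition gauss_expect (theta : 'rV[R]_p) (F : 'rV[R]_p -> \bar R) : \bar R :=
  foldr (gauss_step theta) F (enum 'I_p) 0.

Definition shrink_est (phi : R -> R) (x : 'rV[R]_p) : 'rV[R]_p :=
  (1 - phi (sqnorm x) / sqnorm x) *: x.

Definition risk (theta : 'rV[R]_p) (est : 'rV[R]_p -> 'rV[R]_p) : \bar R :=
  gauss_expect theta (fun x => (sqnorm (est x - theta))%:E).

Definition js_est : 'rV[R]_p -> 'rV[R]_p := shrink_est (fun _ => p%:R - 2).

Definition phi_of (Phi : R -> R) (C : R) (w : R) : R :=
  p%:R - 2 -
  (fine (\int[lebesgue_measure]_(t in `]0%R, w]%classic) (Phi t / t)%:E)%E + C)^-1.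

End Defs.

(* Main.v *)
(** Write G = 1 / (I + C), so that phi = p - 2 - G.  By Stein's identity the risk
    difference (James-Stein minus phi) at theta is the expectation of
    G^2 (4 Phi - 1) / w at w = |X|^2, which changes sign at most once, from - to +.
    The density of |X|^2 at theta relative to the one at 0 is nondecreasing, so
    nonnegativity at 0 propagates to every theta.

    Everything is done along rays.  Tonelli and scaling give, for F >= 0,
      int F = int kap(x) (int_0^oo r^(p-1) F(r x/|x|) dr) dx,
    with kap supported in a spherical shell; this replaces polar coordinates.
    On a ray, Stein's identity is a one-dimensional integration by parts (again
    Tonelli, since Phi may jump), and the relative density is the average over
    x of exp(r theta.x/|x|), which is monotone after symmetrizing x -> -x. *)

Require Import Defs.
From HB Require Import structures.
From mathcomp Require Import all_boot all_order all_algebra.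
From mathcomp Require Import ring lra.
From mathcomp Require Import all_classical all_reals all_analysis.
From mathcomp Require Import measurable_realfun.
Import Order.TTheory GRing.Theory Num.Theory.
Import numFieldNormedType.Exports.
Local Open Scope classical_set_scope.
Local Open Scope ring_scope.

(** * Scaling in one dimension *)

(** The denominator in phi is built so that, as a function of w, G' = - G^2 Phi / w. On a ray with
    unit direction u put b = theta.u and M = r^(p-2) exp(r b - r^2/2). Weighted by r^(p-1) exp(r b -
    r^2/2), the loss of phi minus that of James-Stein is - 2 G M' + G^2 M / r; the constant p - 2 of
    the estimator is the exponent that completes M'. Integration by parts moves the derivative to G,
    where dG/dr = - 2 G^2 Phi / r, so both terms become multiples of G^2 M / r. This is the origin
    of the factor 4 Phi - 1.

    All integrals are extended-real and handled by Tonelli. Hence M' is split into two nonnegative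
    functions, every identity equates sums of nonnegative integrals, and a term is cancelled only
    once it is known to be finite.

    Since Phi may jump, G cannot be differentiated everywhere. It is recovered from its rate by
    squeezing the increments of both between the same bounds on short intervals. *)

Section scaling.
Variable R : realType.
Local Notation mu := (@lebesgue_measure R).

Lemma measurable_inv : measurable_fun [set: R] (fun x : R => x^-1).
Proof.
(* The square makes the base of [powR] nonnegative, where exponent -1 is the inverse; at 0 both
   sides are 0 by convention. *)
rewrite (_ : (fun x => _) = (fun x : R => x * ((x ^+ 2) `^ (-1)))).
  apply: measurable_funM => //.
  by apply: (@measurableT_comp _ _ _ _ _ _ (fun y : R => y `^ (-1))) => //; exact: measurable_powR.
apply/funext => x; rewrite powR_inv1 ?sqr_ge0//.
have [->|x0] := eqVneq x 0; first by rewrite invr0 mul0r.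
by field.
Qed.

Lemma measurable_funV d (T : measurableType d) (f : T -> R) :
  measurable_fun setT f -> measurable_fun setT (fun x => (f x)^-1).
Proof. by move=> mf; apply: measurableT_comp => //; exact: measurable_inv. Qed.

(** Multiplying by [a] the pushforward of Lebesgue measure under x -> a x gives back the length of
    every half-open interval, hence Lebesgue measure by uniqueness. *)
Lemma ge0_integral_scale (a : R) (f : R -> \bar R) : 0 < a ->
  measurable_fun setT f -> (forall x, (0 <= f x)%E) ->
  (\int[mu]_x f x = a%:E * \int[mu]_x f (a * x)%R)%E.
Proof.
move=> a0 mf f0.
have ma : measurable_fun [set: measurableTypeR R] (fun x : R => a * x : measurableTypeR R).
  exact: mulrl_measurable.
pose a' : {nonneg R} := NngNum (ltW a0).
pose push : {measure set (measurableTypeR R) -> \bar R} :=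
  pushforward mu (fun x : R => a * x : measurableTypeR R).
pose nu : {measure set (measurableTypeR R) -> \bar R} := mscale a' (push ma).
transitivity (\int[nu]_x f x)%E.
  apply: eq_measure_integral => A mA _.
  apply: (@lebesgue_measure_unique R nu) => // X [[x y]] _ <-/=.
  rewrite /nu /mscale/= /pushforward/=.
  rewrite (_ : _ @^-1` _ = `]x / a, y / a]%classic); last first.
    apply/seteqP; split => z /=; rewrite !in_itv/= ltr_pdivrMr// ler_pdivlMr// ![z * a]mulrC //.
  rewrite !lebesgue_measure_itv/= !lte_fin ltr_pM2r ?invr_gt0//.
  case: ifPn => _; last by rewrite mule0.
  by rewrite -!EFinB -EFinM -mulrBl mulrCA mulfV ?gt_eqF// mulr1.
rewrite /nu ge0_integral_mscale//=; congr (_ * _)%E.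
by rewrite ge0_integral_pushforward//= preimage_setT.
Qed.

Lemma ge0_integral_opp (f : R -> \bar R) :
  measurable_fun setT f -> (forall x, (0 <= f x)%E) ->
  (\int[mu]_x f x = \int[mu]_x f (- x)%R)%E.
Proof.
move=> mf f0.
transitivity (\int[pushforward mu (-%R : _ -> measurableTypeR R)]_x f x)%E.
  apply: eq_measure_integral => A mA _; exact/esym/lebesgue_measureN.
by rewrite ge0_integral_pushforward//= preimage_setT.
Qed.

Lemma ge0_integral_scale_pos (a : R) (f : R -> \bar R) : 0 < a ->
  measurable_fun setT f -> (forall x, 0 < x -> (0 <= f x)%E) ->
  (\int[mu]_(x in `]0%R, +oo[) f x = a%:E * \int[mu]_(x in `]0%R, +oo[) f (a * x)%R)%E.
Proof.
move=> a0 mf f0; rewrite integral_mkcond (@ge0_integral_scale a)//.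
- congr (_ * _)%E; rewrite [RHS]integral_mkcond; apply: eq_integral => x _.
  rewrite !patchE; congr (if _ then _ else _).
  by apply/idP/idP; rewrite !inE/= !in_itv/= !andbT pmulr_rgt0.
- by apply/(measurable_restrictT _ _).1 => //; exact: measurable_funTS.
- move=> x; rewrite patchE; case: ifPn => //; rewrite inE/= in_itv/= andbT => ?; exact: f0.
Qed.

End scaling.

(** * Iterated Lebesgue integrals on row vectors *)

Section iterated_integral.
Variables (R : realType) (p : nat).
Local Notation mu := (@lebesgue_measure R).
Local Notation V := 'rV[R]_p.

(* 'rV[R]_p carries no sigma-algebra, so measurability is tested along
   coordinatewise measurable maps into it. *)
Definition jmeas (f : R -> V -> \bar R) : Prop :=
  forall d (T : measurableType d) (u : T -> R) (c : T -> V),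
    measurable_fun setT u -> (forall i, measurable_fun setT (fun t => c t 0 i)) ->
    measurable_fun setT (fun t => f (u t) (c t)).

Definition cmeas (F : V -> \bar R) := jmeas (fun _ => F).

Definition leb_step (i : 'I_p) (F : V -> \bar R) (x : V) : \bar R :=
  (\int[mu]_t F (setcoord x i t))%E.

Definition leb_iter (s : seq 'I_p) (F : V -> \bar R) : V -> \bar R :=
  foldr leb_step F s.

Definition leb (F : V -> \bar R) : \bar R := leb_iter (enum 'I_p) F 0.

Lemma measurable_setcoord d (T : measurableType d) (u : T -> R) (c : T -> V) i :
  measurable_fun setT u -> (forall j, measurable_fun setT (fun t => c t 0 j)) ->
  forall j, measurable_fun setT (fun t => setcoord (c t) i (u t) 0 j).
Proof.
move=> mu0 mc j.
rewrite (_ : (fun t => _) = (fun t => if j == i then u t else c t 0 j)).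
  by case: (j == i).
by apply/funext => t; rewrite mxE.
Qed.

Lemma jmeasW (f : R -> V -> \bar R) u : jmeas f -> cmeas (f u).
Proof. by move=> mf d T v c mv mc; apply: mf. Qed.

Lemma cmeas_measurable (F : V -> \bar R) d (T : measurableType d) (c : T -> V) :
  cmeas F -> (forall i, measurable_fun setT (fun t => c t 0 i)) ->
  measurable_fun setT (fun t => F (c t)).
Proof. by move=> mF mc; apply: (mF _ _ (fun=> 0)). Qed.

Lemma cmeas_setcoord (F : V -> \bar R) i x : cmeas F ->
  measurable_fun setT (fun t : R => F (setcoord x i t)).
Proof.
move=> mF; apply: (@cmeas_measurable F _ _ (fun t => setcoord x i t)) => //.
by apply: measurable_setcoord.
Qed.

(** Quantifying over all spaces [T] makes the class stable under integration: [T * R], with the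
    second component written into coordinate [i], is again a test space, and Tonelli gives
    measurability of the partial integral. *)
Lemma jmeas_leb_step i (f : R -> V -> \bar R) : jmeas f ->
  (forall u x, (0 <= f u x)%E) -> jmeas (fun u => leb_step i (f u)).
Proof.
move=> mf f0 d T u c mu0 mc.
pose g (z : T * R) := f (u z.1) (setcoord (c z.1) i z.2).
have mg : measurable_fun setT g.
  apply: mf; first by apply: measurableT_comp.
  apply: (@measurable_setcoord _ _ snd (fun z : T * R => c z.1)) => // j.
  exact: (@measurableT_comp _ _ _ _ _ _ (fun t => c t 0 j)).
apply: (@measurable_fun_fubini_tonelli_F _ _ _ _ _ mu g mg) => z; exact: f0.
Qed.

Lemma leb_iter_ge0 s (F : V -> \bar R) : (forall x, (0 <= F x)%E) ->
  forall x, (0 <= leb_iter s F x)%E.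
Proof.
by move=> F0; elim: s => //= i s ih x; apply: integral_ge0 => t _; exact: ih.
Qed.

Lemma jmeas_leb_iter s (f : R -> V -> \bar R) : jmeas f ->
  (forall u x, (0 <= f u x)%E) -> jmeas (fun u => leb_iter s (f u)).
Proof.
move=> mf f0; elim: s => //= i s ih.
by apply: jmeas_leb_step => // u x; exact: leb_iter_ge0.
Qed.

Lemma cmeas_leb_iter s F : cmeas F ->
  (forall x, (0 <= F x)%E) -> cmeas (leb_iter s F).
Proof. by move=> mF F0; apply: (@jmeas_leb_iter s (fun=> F)). Qed.

Lemma leb_iter_tonelli s (f : R -> V -> \bar R) : jmeas f ->
  (forall u x, (0 <= f u x)%E) -> forall x,
  (leb_iter s (fun x => \int[mu]_u f u x) x = \int[mu]_u leb_iter s (f u) x)%E.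
Proof.
move=> mf f0; elim: s => //= i s ih x.
rewrite /leb_step.
under eq_integral do rewrite ih.
pose g (z : R * R) := leb_iter s (f z.2) (setcoord x i z.1).
rewrite (@fubini_tonelli _ _ _ _ _ mu mu g)//.
  apply: (@jmeas_leb_iter s f mf f0 _ _ snd (fun z => setcoord x i z.1)) => //.
  exact: measurable_setcoord.
by move=> z; exact: leb_iter_ge0.
Qed.

Lemma le_leb_iter s (F G : V -> \bar R) : cmeas F -> cmeas G ->
  (forall x, (0 <= F x)%E) -> (forall x, (F x <= G x)%E) ->
  forall x, (leb_iter s F x <= leb_iter s G x)%E.
Proof.
move=> mF mG F0 FG; have G0 x : (0 <= G x)%E by exact: le_trans (FG x).
elim: s => //= i s ih x; apply: ge0_le_integral => //.
- by move=> t _; exact: leb_iter_ge0.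
- by apply: cmeas_setcoord; exact: cmeas_leb_iter.
- by apply: cmeas_setcoord; exact: cmeas_leb_iter.
Qed.

Lemma leb_iterD s (F G : V -> \bar R) : cmeas F -> cmeas G ->
  (forall x, (0 <= F x)%E) -> (forall x, (0 <= G x)%E) ->
  forall x, (leb_iter s (fun x => F x + G x) x = leb_iter s F x + leb_iter s G x)%E.
Proof.
move=> mF mG F0 G0; elim: s => //= i s ih x.
rewrite /leb_step; under eq_integral do rewrite ih.
rewrite ge0_integralD//.
- by move=> t _; exact: leb_iter_ge0.
- by apply: cmeas_setcoord; exact: cmeas_leb_iter.
- by move=> t _; exact: leb_iter_ge0.
- by apply: cmeas_setcoord; exact: cmeas_leb_iter.
Qed.

Lemma leb_iterMl s (c : V -> \bar R) (F : V -> \bar R) : cmeas F ->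
  (forall x, (0 <= F x)%E) -> (forall x, (0 <= c x)%E) ->
  (forall i t x, i \in s -> c (setcoord x i t) = c x) ->
  forall x, (leb_iter s (fun x => c x * F x) x = c x * leb_iter s F x)%E.
Proof.
move=> mF F0 c0; elim: s => //= i s ih cs x.
rewrite /leb_step; under eq_integral.
  move=> t _; rewrite ih ?cs ?mem_head//; last first.
    by move=> j u y js; apply: cs; rewrite in_cons js orbT.
  over.
rewrite ge0_integralZl//.
- by apply: cmeas_setcoord; exact: cmeas_leb_iter.
- by move=> t _; exact: leb_iter_ge0.
Qed.

Lemma scale_setcoord a (x : V) i t : a *: setcoord x i t = setcoord (a *: x) i (a * t).
Proof. by apply/rowP => j; rewrite !mxE; case: (j == i). Qed.

(** The base point is scaled along with the variables so that the induction passes through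
    [setcoord]; each coordinate contributes one factor [a], and at base point 0 this is the usual
    Jacobian. *)
Lemma leb_iter_scale s a (F : V -> \bar R) : 0 < a -> cmeas F ->
  (forall x, (0 <= F x)%E) -> forall x,
  (leb_iter s F (a *: x) = (a ^+ size s)%:E * leb_iter s (fun x => F (a *: x)) x)%E.
Proof.
move=> a0 mF F0.
have mFa : cmeas (fun x => F (a *: x)).
  move=> d T u c mu0 mc; apply: (@cmeas_measurable F _ _ (fun t => a *: c t)) => //.
  move=> i; rewrite (_ : (fun t => _) = (fun t => a * c t 0 i)); first exact: measurable_funM.
  by apply/funext => t; rewrite mxE.
elim: s => [x|i s ih x]; first by rewrite /= expr0 mul1e.
rewrite /= /leb_step (@ge0_integral_scale _ a)//.
- under eq_integral do rewrite -scale_setcoord ih.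
  rewrite ge0_integralZl//.
  + by rewrite exprS EFinM muleA.
  + by apply: cmeas_setcoord; exact: cmeas_leb_iter.
  + by move=> t _; exact: leb_iter_ge0.
  + by rewrite lee_fin exprn_ge0 ?ltW.
- by apply: cmeas_setcoord; exact: cmeas_leb_iter.
- by move=> t; exact: leb_iter_ge0.
Qed.

Lemma opp_setcoord (x : V) i t : - setcoord x i t = setcoord (- x) i (- t).
Proof. by apply/rowP => j; rewrite !mxE; case: (j == i). Qed.

Lemma leb_iter_opp s (F : V -> \bar R) : cmeas F ->
  (forall x, (0 <= F x)%E) -> forall x,
  (leb_iter s F (- x) = leb_iter s (fun x => F (- x)%R) x)%E.
Proof.
move=> mF F0; elim: s => [x//|i s ih x].
rewrite /= /leb_step ge0_integral_opp//.
- by apply: eq_integral => t _; rewrite -ih opp_setcoord.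
- by apply: cmeas_setcoord; exact: cmeas_leb_iter.
- by move=> t; exact: leb_iter_ge0.
Qed.

(* The origin is a null set: already the innermost integral ignores it. *)
Lemma eq_leb (F G : V -> \bar R) : (0 < p)%N -> cmeas F -> cmeas G ->
  (forall x, (0 <= F x)%E) -> (forall x, (0 <= G x)%E) ->
  (forall x, x != 0 -> F x = G x) -> leb F = leb G.
Proof.
move=> p0 mF mG F0 G0 FG; rewrite /leb.
case/lastP E : (enum 'I_p) => [|s i].
  by have := size_enum_ord p; rewrite E/= => p_eq0; rewrite -p_eq0 in p0.
rewrite -!cats1 /leb_iter !foldr_cat/=; congr (foldr _ _ _ _).
apply/funext => x; rewrite /leb_step.
have mFi := cmeas_setcoord F i x mF; have mGi := cmeas_setcoord G i x mG.
rewrite (@ge0_negligible_integral _ _ _ mu setT [set 0%R])//; last 1 first.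
  exact: lebesgue_measure_set1.
rewrite [RHS](@ge0_negligible_integral _ _ _ mu setT [set 0%R])//; last 1 first.
  exact: lebesgue_measure_set1.
apply: eq_integral => t; rewrite inE/= => -[_ /eqP t0]; apply: FG.
by apply: contraNneq t0 => /rowP/(_ i); rewrite !mxE eqxx => ->.
Qed.

End iterated_integral.

(** * Integration along rays *)

Section polar.
Variables (R : realType) (p : nat).
Local Notation mu := (@lebesgue_measure R).
Local Notation V := 'rV[R]_p.

Lemma cmeas_mul (F G : V -> \bar R) : cmeas R p F -> cmeas R p G ->
  cmeas R p (fun x => F x * G x)%E.
Proof.
move=> mF mG d T u c mu0 mc.
by apply: emeasurable_funM; [exact: mF mu0 mc|exact: mG mu0 mc].
Qed.

Lemma jmeas_integral (D : set R) (f : R -> V -> \bar R) : measurable D ->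
  jmeas R p f -> (forall u x, D u -> (0 <= f u x)%E) ->
  cmeas R p (fun x => \int[mu]_(u in D) f u x)%E.
Proof.
move=> mD mf f0 d T u c mu0 mc.
pose g (z : T * R) := ((\1_D z.2 : R)%:E * f z.2 (c z.1))%E.
rewrite (_ : (fun t => _) = (fun t => \int[mu]_v g (t, v))%E); last first.
  apply/funext => t; rewrite integral_mkcond; apply: eq_integral => v _.
  by rewrite patchE /g/= indicE; case: (v \in D); rewrite ?mul1e ?mul0e.
apply: (@measurable_fun_fubini_tonelli_F _ _ _ _ _ mu g).
  apply: emeasurable_funM.
    apply/measurable_EFinP; apply: (@measurableT_comp _ _ _ _ _ _ (\1_D : R -> R)) => //.
  apply: mf => // i.
  exact: (@measurableT_comp _ _ _ _ _ _ (fun t => c t 0 i)).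
move=> z; rewrite /g indicE; case: (boolP (z.2 \in D)); rewrite ?mul0e// inE => ?.
by rewrite mul1e f0.
Qed.

Lemma leb0 : leb R p (fun=> 0%E) = 0%E.
Proof.
rewrite /leb; suff H s x : leb_iter R p s (fun=> 0%E) x = 0%E by [].
by elim: s x => //= i s ih x; apply: integral0_eq => t _; rewrite ih.
Qed.

Lemma leb_tonelli (D : set R) (f : R -> V -> \bar R) : measurable D ->
  jmeas R p f -> (forall u x, D u -> (0 <= f u x)%E) ->
  (leb R p (fun x => \int[mu]_(u in D) f u x) = \int[mu]_(u in D) leb R p (f u))%E.
Proof.
move=> mD mf f0.
pose g u x := ((\1_D u : R)%:E * f u x)%E.
have -> : (fun x => \int[mu]_(u in D) f u x)%E = (fun x => \int[mu]_u g u x)%E.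
  apply/funext => x; rewrite integral_mkcond; apply: eq_integral => u _.
  by rewrite patchE /g indicE; case: (u \in D); rewrite ?mul1e ?mul0e.
rewrite /leb leb_iter_tonelli//.
- rewrite [RHS]integral_mkcond; apply: eq_integral => u _.
  rewrite patchE; case: ifPn => [uD|uD].
    rewrite (_ : g u = f u)//; apply/funext => x.
    by rewrite /g indicE uD mul1e.
  rewrite (_ : g u = fun=> 0%E); first exact: leb0.
  by apply/funext => x; rewrite /g indicE (negbTE uD) mul0e.
- move=> d T u c mu0 mc; apply: emeasurable_funM; last exact: mf.
  apply/measurable_EFinP.
  by apply: (@measurableT_comp _ _ _ _ _ _ (\1_D : R -> R)).
- move=> u x; rewrite /g indicE; case: (boolP (u \in D)); rewrite ?mul0e// inE => ?.
  by rewrite mul1e f0.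
Qed.

Lemma lebZl k (F : V -> \bar R) : cmeas R p F -> (forall x, (0 <= F x)%E) ->
  (0 <= k)%E -> (leb R p (fun x => k * F x) = k * leb R p F)%E.
Proof. by move=> mF F0 k0; rewrite /leb (leb_iterMl _ _ _ (fun=> k)). Qed.

Lemma leb_scale a (F : V -> \bar R) : 0 < a -> cmeas R p F ->
  (forall x, (0 <= F x)%E) ->
  (leb R p F = (a ^+ p)%:E * leb R p (fun x => F (a *: x)%R))%E.
Proof.
move=> a0 mF F0; have := leb_iter_scale _ _ (enum 'I_p) a F a0 mF F0 0.
by rewrite scaler0 size_enum_ord.
Qed.

Lemma leb_opp (F : V -> \bar R) : cmeas R p F ->
  (forall x, (0 <= F x)%E) -> (leb R p F = leb R p (fun x => F (- x)%R))%E.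
Proof.
by move=> mF F0; rewrite /leb -[in LHS]oppr0 leb_iter_opp.
Qed.

Definition enorm (x : V) : R := Num.sqrt (sqnorm x).

Definition dir (x : V) : V := (enorm x)^-1 *: x.

Lemma sqnorm_ge0 (x : V) : 0 <= sqnorm x.
Proof. by apply: sumr_ge0 => i _; exact: sqr_ge0. Qed.

Lemma sqnormZ a (x : V) : sqnorm (a *: x) = a ^+ 2 * sqnorm x.
Proof. by rewrite /sqnorm mulr_sumr; apply: eq_bigr => i _; rewrite mxE exprMn. Qed.

Lemma sqnorm_eq0 (x : V) : sqnorm x = 0 -> x = 0.
Proof.
move/eqP; rewrite psumr_eq0 => [/allP x0|i _]; last exact: sqr_ge0.
apply/rowP => i; rewrite mxE; apply/eqP; rewrite -sqrf_eq0.
by apply: x0; rewrite mem_index_enum.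
Qed.

Lemma enorm_gt0 (x : V) : x != 0 -> 0 < enorm x.
Proof.
move=> x0; rewrite sqrtr_gt0 lt_neqAle sqnorm_ge0 andbT eq_sym.
by apply: contra_neq x0; exact: sqnorm_eq0.
Qed.

Lemma enormZ a (x : V) : 0 <= a -> enorm (a *: x) = a * enorm x.
Proof. by move=> a0; rewrite /enorm sqnormZ sqrtrM ?sqr_ge0// sqrtr_sqr ger0_norm. Qed.

Lemma sqnorm_dir (x : V) : x != 0 -> sqnorm (dir x) = 1.
Proof.
move=> /enorm_gt0 x0; rewrite sqnormZ -[sqnorm x]sqr_sqrtr ?sqnorm_ge0// -/(enorm x).
by rewrite -exprMn mulVf ?expr1n// gt_eqF.
Qed.

Lemma measurable_sqnorm d (T : measurableType d) (c : T -> V) :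
  (forall i, measurable_fun setT (fun t => c t 0 i)) ->
  measurable_fun setT (fun t => sqnorm (c t)).
Proof.
by move=> mc; apply: measurable_sum => i; apply: measurable_funX.
Qed.

Lemma measurable_enorm d (T : measurableType d) (c : T -> V) :
  (forall i, measurable_fun setT (fun t => c t 0 i)) ->
  measurable_fun setT (fun t => enorm (c t)).
Proof.
move=> mc; apply: (@measurableT_comp _ _ _ _ _ _ (@Num.sqrt R)); last exact: measurable_sqnorm.
by apply: continuous_measurable_fun; exact: sqrt_continuous.
Qed.

Lemma measurable_scale_coord d (T : measurableType d) (u : T -> R) (c : T -> V) :
  measurable_fun setT u -> (forall i, measurable_fun setT (fun t => c t 0 i)) ->
  forall i, measurable_fun setT (fun t => (u t *: c t) 0 i).
Proof.
move=> mu0 mc i; rewrite (_ : (fun t => _) = (fun t => u t * c t 0 i)).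
  exact: measurable_funM.
by apply/funext => t; rewrite mxE.
Qed.

Lemma measurable_dir d (T : measurableType d) (c : T -> V) :
  (forall i, measurable_fun setT (fun t => c t 0 i)) ->
  forall i, measurable_fun setT (fun t => dir (c t) 0 i).
Proof.
move=> mc; apply: measurable_scale_coord => //.
by apply: measurable_funV; exact: measurable_enorm.
Qed.

(** An interval of length 1, so that the weight has total mass 1, bounded and kept away from 0, so
    that [kap] is bounded with support in 1/2 <= |x| < 1. *)
Definition shell (u : R) : R := \1_(`]1, 2]) u.

Lemma measurable_shell : measurable_fun setT shell.
Proof. exact: measurable_indic. Qed.

Lemma shell_ge0 u : 0 <= shell u. Proof. by rewrite /shell. Qed.

Lemma integral_shell : (\int[mu]_(s in `]0%R, +oo[) (shell s)%:E = 1)%E.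
Proof.
rewrite /shell integral_indic//= setIidl.
  by rewrite lebesgue_measure_itv/= lte_fin ltr1n -EFinB; congr EFin; lra.
by move=> x /=; rewrite !in_itv/= => /andP[? _]; rewrite andbT; lra.
Qed.

(** What remains after the substitutions of [polar]: one factor 1/|x| normalises the shell, one is
    the Jacobian of s = r/|x|, and p - 1 come from s^(p-1). At the origin the convention 0^-1 = 0
    falls outside the shell, so [kap] vanishes there and masks the meaningless direction. *)
Definition kap (x : V) : R := shell (enorm x)^-1 / enorm x ^+ p.+1.

Lemma kap_ge0 x : 0 <= kap x.
Proof. by rewrite mulr_ge0 ?shell_ge0// invr_ge0 exprn_ge0// sqrtr_ge0. Qed.

Lemma measurable_kap d (T : measurableType d) (c : T -> V) :
  (forall i, measurable_fun setT (fun t => c t 0 i)) ->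
  measurable_fun setT (fun t => kap (c t)).
Proof.
move=> mc; apply: measurable_funM.
  apply: (@measurableT_comp _ _ _ _ _ _ shell); first exact: measurable_shell.
  by apply: measurable_funV; exact: measurable_enorm.
by apply: measurable_funV; apply: measurable_funX; exact: measurable_enorm.
Qed.

(** Insert 1 = int_0^oo shell(s/|x|)/|x| ds, exchange the integrals, replace x by s x at fixed s,
    exchange back, and put s = r/|x|. Only Tonelli and linear scaling occur, so no measure on the
    sphere has to be constructed. *)
Lemma polar (F : V -> \bar R) : (0 < p)%N -> cmeas R p F -> (forall x, (0 <= F x)%E) ->
  (leb R p F = leb R p (fun x => (kap x)%:E *
     \int[mu]_(r in `]0%R, +oo[) ((r ^+ p.-1)%:E * F (r *: dir x))))%E.
Proof.
move=> p0 mF F0.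
have xs d (T : measurableType d) (u : T -> R) (c : T -> V) :
    measurable_fun setT u -> (forall i, measurable_fun setT (fun t => c t 0 i)) ->
    measurable_fun setT (fun t => F (u t *: c t)).
  by move=> mu0 mc; apply: (cmeas_measurable _ _ F _ _ (fun t => u t *: c t)) => //;
    exact: measurable_scale_coord.
pose D : set R := `]0%R, +oo[%classic.
have mD : measurable D by exact: measurable_itv.
pose f s x := (`|shell (s / enorm x) / enorm x|%:E * F x)%E.
have f0 u x : (0 <= f u x)%E by rewrite mule_ge0// lee_fin.
have mf : jmeas R p f.
  move=> d T u c mu0 mc; apply: emeasurable_funM; last exact: mF mu0 mc.
  apply/measurable_EFinP; apply: measurableT_comp => //; apply: measurable_funM.
    apply: (@measurableT_comp _ _ _ _ _ _ shell); first exact: measurable_shell.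
    apply: measurable_funM => //.
    by apply: measurable_funV; exact: measurable_enorm.
  by apply: measurable_funV; exact: measurable_enorm.
(* This is [f] after x has become s x: the Jacobian s^p meets the factor 1/s of [f]. The absolute
   value keeps [h] nonnegative for s < 0, outside the domain of integration. *)
pose h s x := (((shell (enorm x)^-1 / enorm x) * `|s| ^+ p.-1)%:E * F (s *: x))%E.
have h0 u x : (0 <= h u x)%E.
  by rewrite mule_ge0// lee_fin !mulr_ge0 ?shell_ge0 ?invr_ge0 ?sqrtr_ge0// exprn_ge0.
have mh : jmeas R p h.
  move=> d T u c mu0 mc; apply: emeasurable_funM; last exact: xs.
  apply/measurable_EFinP; apply: measurable_funM.
    apply: measurable_funM.
      apply: (@measurableT_comp _ _ _ _ _ _ shell); first exact: measurable_shell.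
      by apply: measurable_funV; exact: measurable_enorm.
    by apply: measurable_funV; exact: measurable_enorm.
  by apply: measurable_funX; apply: measurableT_comp.
(* The integral of the inserted weight is 1 except at the origin, where it is 0; [eq_leb] discards
   that point. *)
transitivity (leb R p (fun x => \int[mu]_(s in D) f s x)%E).
  apply: eq_leb => //; [exact: jmeas_integral|by move=> x; apply: integral_ge0|].
  move=> x /enorm_gt0 x0; rewrite /f ge0_integralZr//; last first.
    apply/measurable_EFinP; apply: measurable_funTS; apply: measurableT_comp => //.
    apply: measurable_funM => //; apply: (@measurableT_comp _ _ _ _ _ _ shell); first exact: measurable_shell.
    exact: measurable_funM.
  rewrite (@ge0_integral_scale_pos _ (enorm x))//; last first.
    apply/measurable_EFinP; apply: measurableT_comp => //.
    apply: measurable_funM => //; apply: (@measurableT_comp _ _ _ _ _ _ shell); first exact: measurable_shell.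
    exact: measurable_funM.
  under eq_integral.
    move=> s _; rewrite ger0_norm ?mulr_ge0 ?shell_ge0 ?invr_ge0 1?ltW// mulrAC mulfV ?gt_eqF// mul1r.
    rewrite EFinM; over.
  rewrite ge0_integralZr//.
  - by rewrite integral_shell mul1e -EFinM mulfV ?gt_eqF// mul1e.
  - by apply/measurable_EFinP; apply: measurable_funTS; exact: measurable_shell.
  - by move=> r _; rewrite lee_fin shell_ge0.
  - by rewrite lee_fin invr_ge0 ltW.
rewrite leb_tonelli//.
transitivity (\int[mu]_(s in D) leb R p (h s))%E.
  apply: eq_integral => s; rewrite inE /D/= in_itv/= andbT => s0.
  rewrite (leb_scale s)//; last exact: jmeasW.
  rewrite -lebZl//; last 2 first.
  - move=> d T u c mu0 mc.
    apply: (cmeas_measurable _ _ (f s) _ _ (fun t => s *: c t)) => //.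
    exact: jmeasW.
    exact: measurable_scale_coord.
  - by rewrite lee_fin exprn_ge0// ltW.
  congr (leb _ _ _); apply/funext => x; rewrite /f /h muleA -EFinM; congr (_%:E * _)%E.
  have [x0|/enorm_gt0 x0] := eqVneq x 0.
    by rewrite x0 scaler0 /enorm/sqnorm big1 ?sqrtr0 ?invr0 ?mulr0 ?normr0 ?mulr0 ?mul0r// => i _; rewrite mxE expr0n.
  rewrite enormZ ?ltW// !ger0_norm ?mulr_ge0 ?shell_ge0 ?invr_ge0 ?mulr_ge0 ?(ltW s0) ?(ltW x0)//.
  have -> : s / (s * enorm x) = (enorm x)^-1 by field; rewrite !gt_eqF.
  by rewrite -[in LHS](prednK p0) exprSr; field; rewrite !gt_eqF.
rewrite -(leb_tonelli D h)//; congr (leb _ _ _); apply/funext => x.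
have [x0|/enorm_gt0 x0] := eqVneq x 0.
  have n0 : enorm x = 0.
    by rewrite x0 /enorm/sqnorm big1 ?sqrtr0// => i _; rewrite mxE expr0n.
  rewrite /h /kap n0 expr0n/= invr0 mulr0 mul0e.
  by apply: integral0_eq => r _; rewrite mul0r mul0e.
have mhx : measurable_fun setT (fun r : R => h r x) by apply: mh => //.
rewrite /D [LHS](@ge0_integral_scale_pos _ (enorm x)^-1) ?invr_gt0//.
rewrite -!ge0_integralZl//.
- apply: eq_integral => r; rewrite inE /D/= in_itv/= andbT => r0.
  have -> : r *: dir x = ((enorm x)^-1 * r) *: x by rewrite /dir scalerA mulrC.
  rewrite /h /kap !muleA -!EFinM; congr (_%:E * _)%E.
  rewrite ger0_norm ?mulr_ge0 ?invr_ge0 1?ltW// exprMn exprVn.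
  have -> : enorm x ^+ p.+1 = enorm x * enorm x * enorm x ^+ p.-1.
    by rewrite -mulrA -!exprS prednK.
  by field; rewrite expf_neq0 gt_eqF//.
- apply: measurable_funTS; apply: emeasurable_funM.
    by apply/measurable_EFinP; exact: measurable_funX.
  by apply: (xs _ _ id (fun=> dir x)).
- by move=> r; rewrite /= in_itv/= andbT => r0; rewrite mule_ge0// lee_fin exprn_ge0// ltW.
- by rewrite lee_fin kap_ge0.
- apply: measurable_funTS; apply: (measurableT_comp mhx).
  exact: measurable_funM.
- by rewrite lee_fin invr_ge0 ltW.
Qed.

End polar.

(** * One-dimensional calculus *)

Section calculus.
Variable R : realType.
Local Notation mu := (@lebesgue_measure R).

(* Splitting [a, b] into n equal pieces bounds the total increment by
   (V b - V a) K (b - a) / n. *)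
Lemma small_increments_const (D V : R -> R) (a b K : R) : a <= b ->
  (forall x y, a <= x -> x <= y -> y <= b ->
     `|D y - D x| <= (V y - V x) * (K * (y - x))) ->
  D b = D a.
Proof.
move=> ab Dab; apply/eqP; rewrite -subr_eq0 -normr_le0 leNgt; apply/negP => D0.
set e := `|D b - D a| in D0.
have key n : (0 < n)%N -> e * n%:R <= (V b - V a) * (K * (b - a)).
  move=> n0; have n0' : (0 : R) < n%:R by rewrite ltr0n.
  pose h := (b - a) / n%:R; pose x k := a + k%:R * h.
  have h0 : 0 <= h by rewrite divr_ge0// subr_ge0.
  have xn : x n = b by rewrite /x /h; field; rewrite gt_eqF.
  have x0 : x 0%N = a by rewrite /x mul0r addr0.
  have xx k : x k.+1 - x k = h by rewrite /x -natr1; ring.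
  have x_ge k : a <= x k by rewrite /x lerDl mulr_ge0.
  have main k : (k <= n)%N -> `|D (x k) - D a| <= (V (x k) - V a) * (K * h).
    elim: k => [_|k ih kn]; first by rewrite x0 !subrr normr0 mul0r.
    have xk1 : x k.+1 <= b by rewrite -xn /x lerD2l ler_wpM2r// ler_nat.
    have xk : x k <= x k.+1 by rewrite -subr_ge0 xx.
    have := ih (ltnW kn); have := Dab (x k) (x k.+1) (x_ge k) xk xk1.
    have := ler_normD (D (x k.+1) - D (x k)) (D (x k) - D a).
    rewrite xx addrA subrK; lra.
  have := main n (leqnn n); rewrite xn -/e => /(ler_wpM2r (ltW n0')) /le_trans; apply.
  by rewrite /h le_eqVlt; apply/orP; left; apply/eqP; field; rewrite gt_eqF.
(* A number of pieces larger than the bound divided by [e] contradicts [key]. *)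
have := truncnS_gt ((V b - V a) * (K * (b - a)) / e).
by rewrite ltr_pdivrMr// ltNge mulrC key.
Qed.

Lemma integral_invr (x y : R) : 0 < x -> x <= y ->
  (\int[mu]_(t in `]x, y]) (t^-1)%:E = (ln y - ln x)%:E)%E.
Proof.
move=> x0; rewrite le_eqVlt => /predU1P[<-|xy].
  by rewrite subrr set_itvoc0 integral_set0.
rewrite integral_itv_obnd_cbnd; last first.
  by apply/measurable_EFinP; apply: measurable_funTS; exact: measurable_inv.
rewrite (@continuous_FTC2 _ _ (@ln R))//.
- apply: continuous_in_subspaceT => t; rewrite inE/= in_itv/= => /andP[xt _].
  by apply: inv_continuous; rewrite gt_eqF// (lt_le_trans x0).
- split.
  + move=> t; rewrite in_itv/= => /andP[xt _].
    by have := is_derive1_ln (lt_trans x0 xt) => -[].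
  + by apply: cvg_at_right_filter; apply: continuous_ln.
  + by apply: cvg_at_left_filter; apply: continuous_ln; exact: lt_trans xy.
- move=> t; rewrite in_itv/= => /andP[xt _]; rewrite derive1E.
  by have /@derive_val -> := is_derive1_ln (lt_trans x0 xt).
Qed.

Lemma ge0_integral_itvU (f : R -> \bar R) (x y z : R) : x <= y -> y <= z ->
  measurable_fun setT f -> (forall t, x < t -> (0 <= f t)%E) ->
  (\int[mu]_(t in `]x, z]) f t = \int[mu]_(t in `]x, y]) f t + \int[mu]_(t in `]y, z]) f t)%E.
Proof.
move=> xy yz mf f0.
have -> : `]x, z]%classic = `]x, y]%classic `|` `]y, z]%classic.
  apply/seteqP; split => t /=; rewrite !in_itv/=.
    by move=> /andP[-> ->]; case: (leP t y) => ?; [left|right].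
  by case=> /andP[h1 h2]; apply/andP; split => //; lra.
rewrite ge0_integral_setU//.
- exact: measurable_funTS.
- by move=> t /= [] /=; rewrite in_itv/= => /andP[h1 h2]; apply: f0 => //; lra.
- apply/disj_setPS => t [] /=; rewrite !in_itv/= => /andP[? ?] /andP[? ?]; lra.
Qed.

(** Used for both Phi and the numerator of [gain_rate], which are integrated against dt/t: their
    integrals get compared with the same logarithm. *)
Lemma integral_divr_bounds (h : R -> R) (x y lo hi : R) : 0 < x -> x <= y ->
  measurable_fun setT h -> 0 <= lo ->
  (forall t, x < t -> t <= y -> lo <= h t <= hi) ->
  ((lo * (ln y - ln x))%:E <= \int[mu]_(t in `]x, y]) (h t / t)%:E <=
   (hi * (ln y - ln x))%:E)%E.
Proof.
move=> x0 xy mh lo0 hP.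
have mi (k : R -> R) : measurable_fun setT k -> measurable_fun `]x, y] (fun t : R => (k t / t)%:E).
  move=> mk; apply/measurable_EFinP; apply: measurable_funTS.
  by apply: measurable_funM => //; exact: measurable_inv.
have cst c : 0 <= c -> (\int[mu]_(t in `]x, y]) (c / t)%:E = (c * (ln y - ln x))%:E)%E.
  move=> c0; under eq_integral do rewrite EFinM.
  rewrite ge0_integralZl//= ?integral_invr// ?lee_fin//.
    by apply/measurable_EFinP; apply: measurable_funTS; exact: measurable_inv.
  move=> t; rewrite /= in_itv/= => /andP[xt _].
  by rewrite lee_fin invr_ge0; lra.
have tP t : t \in `]x, y] -> [/\ 0 <= t^-1, x < t & t <= y].
  by rewrite in_itv/= => /andP[? ?]; split => //; rewrite invr_ge0; lra.
have h0 t : t \in `]x, y] -> 0 <= h t.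
  by move=> /tP[_ xt ty]; have /andP[+ _] := hP t xt ty; exact: le_trans.
apply/andP; split.
  rewrite -cst//; apply: ge0_le_integral => //.
  - by move=> t /tP[t0 _ _]; rewrite lee_fin mulr_ge0.
  - exact: mi.
  - exact: mi.
  - move=> t /tP[t0 xt ty]; rewrite lee_fin ler_wpM2r//.
    by have /andP[] := hP t xt ty.
(* The sign of [hi] can be read off only at a point of the interval, so the empty interval is
   treated apart. *)
have [<-|xy'] := eqVneq x y.
  by rewrite set_itvoc0 integral_set0 subrr mulr0.
have hi0 : 0 <= hi.
  have {xy'}xy' : x < y by rewrite lt_neqAle xy' xy.
  have /andP[h1 h2] := hP y xy' (lexx _); lra.
rewrite -cst//; apply: ge0_le_integral => //.
- by move=> t tI; have [t0 _ _] := tP t tI; rewrite lee_fin mulr_ge0// h0.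
- exact: mi.
- exact: mi.
- move=> t /tP[t0 xt ty]; rewrite lee_fin ler_wpM2r//.
  by have /andP[] := hP t xt ty.
Qed.

Lemma measurable_integral_lt (m : R -> R) : measurable_fun setT m ->
  (forall r, 0 < r -> 0 <= m r) ->
  measurable_fun setT (fun s : R => \int[mu]_(r in `]0%R, s[) (m r)%:E)%E.
Proof.
move=> mm m0.
pose f (z : R * R) := (if (0 < z.1) && (z.1 < z.2) then m z.1 else 0)%:E.
rewrite (_ : (fun s => _) = (fun s => \int[mu]_r f (r, s))%E); last first.
  apply/funext => s; rewrite integral_mkcond; apply: eq_integral => r _.
  rewrite patchE /f/=; case: ifPn => rs; first by rewrite inE/= in_itv/= in rs; rewrite rs.
  by rewrite notin_setE/= in_itv/= in rs; rewrite (negbTE (introN idP rs)).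
apply: (@measurable_fun_fubini_tonelli_G _ _ _ _ _ mu f).
  apply/measurable_EFinP; apply: measurable_fun_ifT => //.
    by apply: measurable_and; apply: measurable_fun_ltr.
  exact: (measurableT_comp mm).
by move=> z; rewrite lee_fin; case: ifPn => // /andP[z1 z2]; exact: m0.
Qed.

(** Tonelli on the triangle 0 < r < s. It replaces integration by parts: the tail integral of [g]
    stands for the decreasing function, and the integral of [m] below s for the antiderivative. *)
Lemma tonelli_triangle (m g : R -> R) :
  measurable_fun setT m -> measurable_fun setT g ->
  (forall r, 0 < r -> 0 <= m r) -> (forall s, 0 < s -> 0 <= g s) ->
  (\int[mu]_(r in `]0%R, +oo[) ((m r)%:E * \int[mu]_(s in `]r, +oo[) (g s)%:E) =
   \int[mu]_(s in `]0%R, +oo[) ((g s)%:E * \int[mu]_(r in `]0%R, s[) (m r)%:E))%E.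
Proof.
move=> mm mg m0 g0.
pose f (z : R * R) := (if (0 < z.1) && (z.1 < z.2) then m z.1 * g z.2 else 0)%:E.
have mf : measurable_fun setT f.
  apply/measurable_EFinP; apply: measurable_fun_ifT => //.
    by apply: measurable_and; apply: measurable_fun_ltr.
  apply: measurable_funM; [exact: (measurableT_comp mm)|exact: (measurableT_comp mg)].
have f0 z : (0 <= f z)%E.
  rewrite lee_fin; case: ifPn => // /andP[z1 z2].
  by rewrite mulr_ge0 ?m0 ?g0//; exact: lt_trans z2.
have := @fubini_tonelli _ _ _ _ _ mu mu f mf f0.
rewrite [X in X = _ -> _](_ : _ = \int[mu]_(r in `]0%R, +oo[) ((m r)%:E * \int[mu]_(s in `]r, +oo[) (g s)%:E))%E; last first.
  rewrite [RHS]integral_mkcond; apply: eq_integral => r _; rewrite patchE.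
  case: ifPn; rewrite ?inE ?notin_setE/= in_itv/= andbT.
    move=> r0; rewrite -ge0_integralZl//.
    - rewrite [RHS]integral_mkcond; apply: eq_integral => s _; rewrite patchE /f/= r0/=.
      case: ifPn => rs; first by rewrite mem_set//= in_itv/= andbT.
      by rewrite memNset//= in_itv/= andbT; exact/negP.
    - by apply/measurable_EFinP; exact: measurable_funTS.
    - by move=> s /=; rewrite in_itv/= andbT => rs; rewrite lee_fin g0//; lra.
    - by rewrite lee_fin m0.
  by move=> /negP r0; apply: integral0_eq => s _; rewrite /f/= (negbTE r0).
move=> ->; rewrite [RHS]integral_mkcond; apply: eq_integral => s _; rewrite patchE.
case: ifPn; rewrite ?inE ?notin_setE/= in_itv/= andbT.
  move=> s0; rewrite -ge0_integralZl//.
  - rewrite [RHS]integral_mkcond; apply: eq_integral => r _; rewrite patchE /f/=.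
    case: ifPn => rs; first by rewrite mem_set//= ?in_itv//= mulrC.
    by rewrite memNset//= in_itv/=; exact/negP.
  - by apply/measurable_EFinP; exact: measurable_funTS.
  - by move=> r /=; rewrite in_itv/= => /andP[r0 _]; rewrite lee_fin m0.
  - by rewrite lee_fin g0.
move=> /negP s0; apply: integral0_eq => r _; rewrite /f/=.
by case: ifPn => // /andP[r0 rs]; case/negP: s0; exact: lt_trans rs.
Qed.

Lemma cvg_integral_oo (f : R -> \bar R) : measurable_fun setT f ->
  (forall r, 0 < r -> (0 <= f r)%E) ->
  (fun n : nat => \int[mu]_(r in `]0%R, n%:R[) f r)%E @ \oo -->
  (\int[mu]_(r in `]0%R, +oo[) f r)%E.
Proof.
move=> mf f0.
have -> : `]0%R, +oo[%classic = \bigcup_n `]0%R, n%:R[%classic :> set R.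
  apply/seteqP; split => r /=; rewrite in_itv/= ?andbT => r0.
    by exists (Num.truncn r).+1 => //=; rewrite in_itv/= r0 truncnS_gt.
  by case: r0 => n _ /=; rewrite in_itv/= => /andP[].
apply: ge0_nondecreasing_set_cvg_integral => //.
- move=> m n mn; rewrite subsetEset => r /=; rewrite !in_itv/= => /andP[-> h].
  by rewrite (lt_le_trans h)// ler_nat.
- by move=> n; exact: measurable_funTS.
- by move=> n r /=; rewrite in_itv/= => /andP[r0 _]; exact: f0.
Qed.

End calculus.

(** * Gaussian weights on the half line with a linear tilt *)

Section tilted_gaussian.
Variables (R : realType) (b : R).
Local Notation mu := (@lebesgue_measure R).

(** The Gaussian density at theta along a ray of unit direction u, up to a factor independent of r
    and u, with [b] = theta.u. *)
Definition tilt (r : R) : R := expR (r * b - r ^+ 2 / 2).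

Lemma tilt_gt0 r : 0 < tilt r. Proof. exact: expR_gt0. Qed.

Lemma measurable_tilt : measurable_fun setT tilt.
Proof.
apply: measurableT_comp => //; apply: measurable_funB; first exact: measurable_funM.
by apply: measurable_funM => //; exact: measurable_funX.
Qed.

Lemma is_derive_tilt (r : R) : is_derive r 1 tilt ((b - r) * tilt r).
Proof.
pose u : R -> R := (b \*: id) - (2^-1 \*: (id ^+ 2)).
have du : is_derive r 1 u (b - r).
  apply: is_derive_eq; rewrite /GRing.scale/=.
  lra.
have -> : tilt = expR \o u.
  apply/funext => t; rewrite /tilt /u/=; congr expR.
  by rewrite /GRing.scale/= mulrC [_ / 2]mulrC.
by apply: is_derive_eq; rewrite mulrC.
Qed.

Lemma is_derive_monomial_tilt (n : nat) (r : R) :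
  is_derive r 1 (fun r => r ^+ n.+1 * tilt r)
    ((n.+1%:R * r ^+ n + b * r ^+ n.+1 - r ^+ n.+2) * tilt r).
Proof.
have := is_derive_tilt r => ?.
have -> : (fun r => r ^+ n.+1 * tilt r) = (id ^+ n.+1 : R -> R) * tilt.
  by apply/funext => t; rewrite mulrfctE exprfctE.
apply: is_derive_eq; rewrite /GRing.scale/= exprfctE !exprS.
ring.
Qed.

Lemma derivable_monomial_tilt (n : nat) (r : R) :
  derivable (fun r : R => r ^+ n * tilt r) r 1.
Proof.
case: n => [|n]; last by have [] := is_derive_monomial_tilt n r.
under eq_fun do rewrite expr0 mul1r.
by have [] := is_derive_tilt r.
Qed.

Lemma measurable_monomial_tilt (n : nat) :
  measurable_fun setT (fun r : R => r ^+ n * tilt r).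
Proof. by apply: measurable_funM; [exact: measurable_funX|exact: measurable_tilt]. Qed.

(** As r <= exp r, a power of r costs no more than a shift of [b], which gives all moments and the
    decay at once. *)
Lemma monomial_tilt_le n r : 0 <= r ->
  r ^+ n * tilt r <= expR (r * (b + n%:R) - r ^+ 2 / 2).
Proof.
move=> r0; have h : r ^+ n <= expR (r * n%:R).
  rewrite expRM_natr lerXn2r ?nnegrE ?expR_ge0//.
  by rewrite (le_trans _ (expR_ge1Dx r))// lerDr.
apply: (le_trans (ler_wpM2r (ltW (tilt_gt0 r)) h)).
by rewrite /tilt -expRD ler_expR; lra.
Qed.

Lemma monomial_tilt_int n :
  (\int[mu]_(r in `]0%R, +oo[) (r ^+ n * tilt r)%:E < +oo)%E.
Proof.
set c := b + n%:R.
(* Completing the square: exp(r c - r^2/2) = exp(c^2/2) exp(-(r - c)^2/2), a multiple of the normal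
   density centred at [c]. *)
pose K := expR (c ^+ 2 / 2) / normal_peak 1.
have K0 : 0 <= K by rewrite divr_ge0 ?expR_ge0 ?normal_peak_ge0.
apply: (@le_lt_trans _ _ (\int[mu]_r (K%:E * (normal_pdf c 1 r)%:E))%E); last first.
  rewrite ge0_integralZl//.
  - by rewrite integral_normal_pdf// mule1 ltry.
  - by apply/measurable_EFinP; exact: measurable_normal_pdf.
  - by move=> r _; rewrite lee_fin normal_pdf_ge0.
have mK : measurable_fun setT (fun r => (K%:E * (normal_pdf c 1 r)%:E)%E).
  by apply/measurable_EFinP; apply: measurable_funM => //; exact: measurable_normal_pdf.
apply: (@le_trans _ _ (\int[mu]_(r in `]0%R, +oo[) (K%:E * (normal_pdf c 1 r)%:E))%E); last first.
  apply: ge0_subset_integral => // r _.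
  by rewrite mule_ge0// lee_fin// normal_pdf_ge0.
apply: ge0_le_integral => //.
- move=> r; rewrite /= in_itv/= andbT => r0.
  by rewrite lee_fin mulr_ge0 ?exprn_ge0 ?(ltW (tilt_gt0 _)) ?(ltW r0).
- by apply/measurable_EFinP; apply: measurable_funTS; exact: measurable_monomial_tilt.
- exact: measurable_funTS.
move=> r; rewrite /= in_itv/= andbT => r0.
rewrite -EFinM lee_fin (le_trans (monomial_tilt_le n r (ltW r0)))//.
have -> : normal_pdf c 1 r = normal_peak 1 * normal_fun c 1 r.
  by rewrite normal_pdfE ?oner_neq0.
have -> : K * (normal_peak 1 * normal_fun c 1 r) = expR (c ^+ 2 / 2) * normal_fun c 1 r.
  by rewrite /K; field; rewrite gt_eqF// normal_peak_gt0// oner_neq0.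
rewrite /normal_fun -expRD ler_expR expr1n -/c.
lra.
Qed.

Lemma monomial_tilt_cvg0 n : (fun k : nat => (k%:R ^+ n * tilt k%:R)%:E) @ \oo --> 0%:E.
Proof.
apply: cvg_EFin; first exact: nearW.
apply: (@squeeze_cvgr _ _ _ _ (fun=> 0) (fun k : nat => expR (- k%:R))).
- near=> k; rewrite mulr_ge0 ?exprn_ge0 ?(ltW (tilt_gt0 _))//=.
  rewrite (le_trans (monomial_tilt_le n k%:R _))// ler_expR.
  have k0 : (0 : R) <= k%:R by [].
  (* For such k the exponent k (b + n) - k^2/2 is at most -k. *)
  have kb : 2 * (b + n%:R + 1) <= k%:R.
    by near: k; exact: nbhs_infty_ger.
  have := ler_wpM2l k0 kb; rewrite expr2; lra.
- exact: cvg_cst.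
- apply: (cvg_comp _ _ _ (@cvgr_expR R)); exact: cvgr_idn.
Unshelve. all: by end_near. Qed.

(** [tilt_up] minus [tilt_down] is the derivative of r^(q+1) [tilt] r. Adding |b| r^(q+1) [tilt] r
    to both makes each nonnegative on the half line, whatever the sign of [b]. *)
Definition tilt_up (q : nat) (r : R) : R :=
  q.+1%:R * (r ^+ q * tilt r) + (`|b| + b) * (r ^+ q.+1 * tilt r).

Definition tilt_down (q : nat) (r : R) : R :=
  r ^+ q.+2 * tilt r + `|b| * (r ^+ q.+1 * tilt r).

Lemma measurable_tilt_up q : measurable_fun setT (tilt_up q).
Proof.
by apply: measurable_funD; apply: measurable_funM => //; exact: measurable_monomial_tilt.
Qed.

Lemma measurable_tilt_down q : measurable_fun setT (tilt_down q).
Proof.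
apply: measurable_funD; first exact: measurable_monomial_tilt.
by apply: measurable_funM => //; exact: measurable_monomial_tilt.
Qed.

Lemma tilt_up_ge0 q r : 0 <= r -> 0 <= tilt_up q r.
Proof.
move=> r0; have := ler_norm (- b); rewrite normrN => h.
have t0 n : 0 <= r ^+ n * tilt r by rewrite mulr_ge0 ?exprn_ge0 ?(ltW (tilt_gt0 _)).
by apply: addr_ge0; apply: mulr_ge0 => //; lra.
Qed.

Lemma tilt_down_ge0 q r : 0 <= r -> 0 <= tilt_down q r.
Proof.
move=> r0.
have t0 n : 0 <= r ^+ n * tilt r by rewrite mulr_ge0 ?exprn_ge0 ?(ltW (tilt_gt0 _)).
by apply: addr_ge0 => //; apply: mulr_ge0.
Qed.

(** The fundamental theorem of calculus, with the negative terms moved to the right. The boundary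
    term at 0 vanishes because the exponent [q.+1] is positive. *)
Lemma integral_tilt_up q s : 0 < s ->
  (\int[mu]_(r in `]0%R, s[) (tilt_up q r)%:E =
   \int[mu]_(r in `]0%R, s[) (tilt_down q r)%:E + (s ^+ q.+1 * tilt s)%:E)%E.
Proof.
move=> s0.
have dup r : derivable (tilt_up q) r 1.
  by apply: derivableD; apply: derivableZ; exact: derivable_monomial_tilt.
have ddown r : derivable (tilt_down q) r 1.
  by apply: derivableD; [|apply: derivableZ]; exact: derivable_monomial_tilt.
have cup : {within `[0, s], continuous (tilt_up q)} by apply: derivable_within_continuous => r _.
have cdown : {within `[0, s], continuous (tilt_down q)} by apply: derivable_within_continuous => r _.
have iup := continuous_compact_integrable (@segment_compact _ 0 s) cup.
have idown := continuous_compact_integrable (@segment_compact _ 0 s) cdown.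
have E : (\int[mu]_(r in `[0%R, s]) (tilt_up q r - tilt_down q r)%:E = (s ^+ q.+1 * tilt s)%:E)%E.
  rewrite (@continuous_FTC2 _ _ (fun r => r ^+ q.+1 * tilt r))//.
  - by rewrite expr0n/= mul0r sube0.
  - by apply: derivable_within_continuous => r _; apply: derivableB.
  - have cM (x : R) : {for x, continuous (fun r : R => r ^+ q.+1 * tilt r)}.
      apply: differentiable_continuous; apply/derivable1_diffP.
      exact: derivable_monomial_tilt.
    split.
    + by move=> r _; exact: derivable_monomial_tilt.
    + by apply: cvg_at_right_filter; exact: cM.
    + by apply: cvg_at_left_filter; exact: cM.
  - move=> r _; rewrite derive1E; have /@derive_val -> := is_derive_monomial_tilt q r.
    by rewrite /tilt_up /tilt_down; ring.
have up : measurable_fun `]0, s[ (fun r => (tilt_up q r)%:E).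
  by apply/measurable_EFinP; apply: measurable_funTS; exact: measurable_tilt_up.
have down : measurable_fun `]0, s[ (fun r => (tilt_down q r)%:E).
  by apply/measurable_EFinP; apply: measurable_funTS; exact: measurable_tilt_down.
rewrite -(integral_itv_bndoo true false up) -(integral_itv_bndoo true false down) -E.
under [X in (_ + X)%E]eq_integral do rewrite EFinB.
rewrite integralB_EFin// addeC subeK//.
exact: integrable_fin_num.
Qed.

Lemma integral_tilt_up_oo q :
  (\int[mu]_(r in `]0%R, +oo[) (tilt_up q r)%:E =
   \int[mu]_(r in `]0%R, +oo[) (tilt_down q r)%:E)%E.
Proof.
have cu : (fun n : nat => \int[mu]_(r in `]0%R, n%:R[) (tilt_up q r)%:E)%E @ \oo -->
    (\int[mu]_(r in `]0%R, +oo[) (tilt_up q r)%:E)%E.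
  apply: cvg_integral_oo => [|r r0]; last by rewrite lee_fin tilt_up_ge0// ltW.
  by apply/measurable_EFinP; exact: measurable_tilt_up.
have cd : (fun n : nat => \int[mu]_(r in `]0%R, n%:R[) (tilt_down q r)%:E)%E @ \oo -->
    (\int[mu]_(r in `]0%R, +oo[) (tilt_down q r)%:E)%E.
  apply: cvg_integral_oo => [|r r0]; last by rewrite lee_fin tilt_down_ge0// ltW.
  by apply/measurable_EFinP; exact: measurable_tilt_down.
have := cvgeD (fin_num_adde_defl _ (isT : (0%:E : \bar R) \is a fin_num)) cd (monomial_tilt_cvg0 q.+1).
rewrite adde0 => cd'.
apply: (cvg_unique _ cu) => //.
apply: cvg_trans (cd' _); apply: near_eq_cvg; near=> n.
rewrite /= integral_tilt_up// ltr0n; near: n; exact: nbhs_infty_gt.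
Unshelve. all: by end_near. Qed.

End tilted_gaussian.

(** * Gaussian expectations along rays *)

Section gaussian.
Variables (R : realType) (p : nat).
Local Notation mu := (@lebesgue_measure R).
Local Notation V := 'rV[R]_p.

Definition dot (theta x : V) : R := \sum_i theta 0 i * x 0 i.

Lemma dotZr theta a x : dot theta (a *: x) = a * dot theta x.
Proof. by rewrite /dot mulr_sumr; apply: eq_bigr => i _; rewrite mxE mulrCA. Qed.

Lemma dotNr theta x : dot theta (- x) = - dot theta x.
Proof. by rewrite -scaleN1r dotZr mulN1r. Qed.

Lemma dot0l x : dot 0 x = 0.
Proof. by rewrite /dot big1// => i _; rewrite mxE mul0r. Qed.

Lemma measurable_dot d (T : measurableType d) theta (c : T -> V) :
  (forall i, measurable_fun setT (fun t => c t 0 i)) ->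
  measurable_fun setT (fun t => dot theta (c t)).
Proof. by move=> mc; apply: measurable_sum => i; exact: measurable_funM. Qed.

Lemma dir_coord_le x i : `|dir R p x 0 i| <= 1.
Proof.
have [->|x0] := eqVneq x 0; first by rewrite /dir scaler0 mxE normr0.
rewrite -(@ler_pXn2r _ 2)// ?nnegrE// expr1n -(sqnorm_dir R p x x0).
rewrite real_normK ?num_real// /sqnorm (bigD1 i)//= lerDl.
by apply: sumr_ge0 => j _; exact: sqr_ge0.
Qed.

(** A coordinatewise bound instead of Cauchy-Schwarz: it serves only to make [mass] grow at most
    exponentially. *)
Lemma dot_dir_le theta x : dot theta (dir R p x) <= \sum_i `|theta 0 i|.
Proof.
apply: ler_sum => i _; apply: (le_trans (ler_norm _)).
by rewrite normrM ler_piMr// dir_coord_le.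
Qed.

(** The density of coordinate i leaves the inner integrals because these move only the coordinates
    in the tail of the list; [uniq] keeps i out of that tail. *)
Lemma foldr_gauss_step theta (F : V -> \bar R) s : uniq s -> cmeas R p F ->
  (forall x, (0 <= F x)%E) -> forall x,
  foldr (gauss_step theta) F s x =
  leb_iter R p s (fun y => F y * (\prod_(i <- s) normal_pdf (theta 0 i) 1 (y 0 i))%:E)%E x.
Proof.
move=> + mF F0; elim: s => [_ x|i s ih /= /andP[is_ us] x]; first by rewrite /= big_nil mule1.
rewrite /gauss_step /leb_step; apply: eq_integral => t _; rewrite ih//.
under [in RHS]eq_fun do rewrite big_cons EFinM muleCA.
rewrite [RHS](leb_iterMl _ _ _ (fun y => (normal_pdf (theta 0 i) 1 (y 0 i))%:E))//.
- by rewrite /= [setcoord x i t 0 i]mxE eqxx muleC.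
- move=> d T u c mu0 mc; apply: emeasurable_funM; first exact: mF mu0 mc.
  apply/measurable_EFinP; apply: measurable_prod => j _.
  by apply: (@measurableT_comp _ _ _ _ _ _ (normal_pdf (theta 0 j) 1)) => //; exact: measurable_normal_pdf.
- by move=> y; rewrite mule_ge0// lee_fin prodr_ge0// => j _; exact: normal_pdf_ge0.
- by move=> y; rewrite lee_fin normal_pdf_ge0.
- move=> j u y js; congr (_%:E); rewrite mxE; case: eqP => // ij.
  by rewrite ij js in is_.
Qed.

Lemma gauss_expectE theta (F : V -> \bar R) : cmeas R p F ->
  (forall x, (0 <= F x)%E) -> gauss_expect theta F =
  leb R p (fun x => F x * (normal_peak 1 ^+ p *
    expR (dot theta x - sqnorm x / 2 - sqnorm theta / 2))%:E)%E.
Proof.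
move=> mF F0; rewrite /gauss_expect foldr_gauss_step ?enum_uniq//.
rewrite /leb; congr (leb_iter _ _ _ _ _); apply/funext => x; congr (_ * _%:E)%E.
rewrite big_enum/= (eq_bigr (fun i => normal_peak 1 * expR (- (x 0 i - theta 0 i) ^+ 2 / 2))).
  rewrite big_split/= prodr_const card_ord -expR_sum; congr (_ * expR _).
  rewrite /dot /sqnorm !mulr_suml -!sumrB; by apply: eq_bigr => i _; field.
by move=> i _; rewrite normal_pdfE ?oner_neq0// /normal_fun expr1n.
Qed.

Lemma gauss_expect1 (theta : V) : gauss_expect theta (fun=> 1%E) = 1%E :> \bar R.
Proof.
rewrite /gauss_expect; suff H s x : foldr (gauss_step theta) (fun=> 1%E) s x = 1%E by [].
elim: s x => //= i s ih x; rewrite /gauss_step.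
under eq_integral do rewrite ih mul1e.
exact: integral_normal_pdf.
Qed.

Lemma cmeas_kap : cmeas R p (fun x => (kap R p x)%:E).
Proof. by move=> d T u c mu0 mc; apply/measurable_EFinP; exact: measurable_kap. Qed.

(** [kap] is bounded with support in the unit ball, where the standard Gaussian density is bounded
    below, so a multiple of that density dominates it. *)
Lemma leb_kap_fin : (leb R p (fun x => (kap R p x)%:E) < +oo)%E.
Proof.
(* On the support, 1/|x| <= 2 bounds [kap] by 2^(p+1), and |x| <= 1 gives exp(1/2 - |x|^2/2) >=
   1. *)
pose K := 2 ^+ p.+1 * expR (2^-1) / normal_peak 1 ^+ p : R.
have peak0 : 0 < normal_peak 1 :> R by rewrite normal_peak_gt0// oner_neq0.
have K0 : 0 <= K by rewrite divr_ge0 ?mulr_ge0 ?expR_ge0 ?exprn_ge0 ?normal_peak_ge0.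
apply: (@le_lt_trans _ _ (K%:E * gauss_expect (0 : V) (fun=> 1%E))%E); last first.
  by rewrite gauss_expect1 mule1 ltry.
have mG : cmeas R p (fun x => 1 * (normal_peak 1 ^+ p *
    expR (dot 0 x - sqnorm x / 2 - sqnorm (0 : V) / 2))%:E)%E.
  move=> d T u c mu0 mc; apply: emeasurable_funM => //; apply/measurable_EFinP.
  apply: measurable_funM => //; apply: measurableT_comp => //.
  apply: measurable_funB => //; apply: measurable_funB; first exact: measurable_dot.
  by apply: measurable_funM => //; exact: measurable_sqnorm.
have G0 x : (0 <= 1 * (normal_peak 1 ^+ p *
    expR (dot 0 x - sqnorm x / 2 - sqnorm (0 : V) / 2))%:E)%E.
  by rewrite mul1e lee_fin mulr_ge0 ?expR_ge0 ?exprn_ge0 ?normal_peak_ge0.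
rewrite gauss_expectE//.
rewrite -lebZl//; apply: le_leb_iter.
- exact: cmeas_kap.
- by apply: (cmeas_mul R p (fun=> K%:E)) => // d T u c mu0 mc; exact: measurable_cst.
- by move=> x; rewrite lee_fin kap_ge0.
move=> x; rewrite mul1e -EFinM lee_fin dot0l.
have -> : sqnorm (0 : V) = 0 by rewrite /sqnorm big1// => i _; rewrite mxE expr0n.
rewrite mul0r subr0 sub0r /K.
have -> : 2 ^+ p.+1 * expR 2^-1 / normal_peak 1 ^+ p *
    (normal_peak 1 ^+ p * expR (- (sqnorm x / 2))) =
    2 ^+ p.+1 * (expR 2^-1 * expR (- (sqnorm x / 2))) :> R.
  by field; rewrite expf_neq0 ?gt_eqF.
rewrite -expRD /kap /shell indicE; case: (boolP (_ \in _)); last first.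
  by move=> _; rewrite mul0r mulr_ge0 ?expR_ge0 ?exprn_ge0.
rewrite inE/= in_itv/= mul1r => /andP[n1 n2].
have n0 : 0 < enorm R p x by rewrite -invr_gt0; lra.
rewrite -exprVn -[leLHS]mulr1 ler_pM// ?exprn_ge0//; first by rewrite invr_ge0 ltW.
  by rewrite lerXn2r ?nnegrE// invr_ge0 ltW.
rewrite -[leLHS]expR0 ler_expR; have : enorm R p x ^+ 2 <= 1.
  rewrite expr_le1 ?(ltW n0)//.
  by rewrite -[leRHS]invr1 -[leLHS]invrK lef_pV2 ?posrE ?invr_gt0// ltW.
rewrite sqr_sqrtr ?sqnorm_ge0// => h; lra.
Qed.

Lemma jmeas_ray (l : V -> R) theta n : cmeas R p (fun x => (l x)%:E) ->
  jmeas R p (fun r x => (r ^+ n * tilt R (dot theta (dir R p x)) r * l (r *: dir R p x))%:E).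
Proof.
move=> ml d T u c mu0 mc; apply/measurable_EFinP.
have md := measurable_dir R p _ _ c mc.
apply: measurable_funM.
  apply: measurable_funM; first exact: measurable_funX.
  apply: measurableT_comp => //; apply: measurable_funB.
    by apply: measurable_funM => //; exact: measurable_dot.
  by apply: measurable_funM => //; exact: measurable_funX.
apply/measurable_EFinP.
apply: (cmeas_measurable _ _ _ _ _ (fun t => u t *: dir R p (c t)) ml) => //.
exact: measurable_scale_coord.
Qed.

Lemma ray_ge0 (l : V -> R) theta n r x : (forall x, 0 <= l x) -> `]0%R, +oo[%classic r ->
  (0 <= (r ^+ n * tilt R (dot theta (dir R p x)) r * l (r *: dir R p x))%:E)%E.
Proof.
move=> l0 /=; rewrite in_itv/= andbT => r0.
by rewrite lee_fin mulr_ge0// mulr_ge0 ?(ltW (tilt_gt0 _ _ _))// exprn_ge0// ltW.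
Qed.

(** The expectation of [l] at [theta] in polar form, without the positive factor shown in
    [gauss_expect_polar]; risks at the same [theta] are compared through it. *)
Definition ray_mass (theta : V) (l : V -> R) : \bar R :=
  leb R p (fun x => (kap R p x)%:E * \int[mu]_(r in `]0%R, +oo[)
    (r ^+ p.-1 * tilt R (dot theta (dir R p x)) r * l (r *: dir R p x))%:E)%E.

Lemma kap0 : kap R p 0 = 0.
Proof.
rewrite /kap /enorm /sqnorm big1 ?sqrtr0 ?invr0; last by move=> i _; rewrite mxE expr0n.
by rewrite /shell indicE memNset ?mul0r//= in_itv/=; lra.
Qed.

Lemma gauss_expect_polar theta (l : V -> R) : (0 < p)%N ->
  cmeas R p (fun x => (l x)%:E) -> (forall x, 0 <= l x) ->
  gauss_expect theta (fun x => (l x)%:E) =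
  ((normal_peak 1 ^+ p * expR (- (sqnorm theta / 2)))%:E * ray_mass theta l)%E.
Proof.
move=> p0 ml l0.
rewrite gauss_expectE//.
set F := (fun x => _ : \bar R).
have F0 x : (0 <= F x)%E.
  by rewrite /F mule_ge0 ?lee_fin// mulr_ge0 ?expR_ge0 ?exprn_ge0 ?normal_peak_ge0.
have mF : cmeas R p F.
  apply: cmeas_mul => // d T u c mu0 mc; apply/measurable_EFinP.
  apply: measurable_funM => //; apply: measurableT_comp => //.
  apply: measurable_funB => //; apply: measurable_funB; first exact: measurable_dot.
  by apply: measurable_funM => //; exact: measurable_sqnorm.
rewrite polar// /ray_mass -lebZl.
- congr (leb _ _ _); apply/funext => x.
  have [->|x0] := eqVneq x 0; first by rewrite kap0 !mul0e mule0.
  rewrite muleCA; congr (_ * _)%E.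
  rewrite -ge0_integralZl//; last 3 first.
  - apply: measurable_funTS.
    exact: (jmeas_ray l theta p.-1 ml _ _ id (fun=> x)).
  - by move=> r r0; exact: ray_ge0.
  - by rewrite lee_fin mulr_ge0 ?expR_ge0 ?exprn_ge0 ?normal_peak_ge0.
  apply: eq_integral => r _; rewrite /F -!EFinM; congr EFin.
  rewrite dotZr sqnormZ sqnorm_dir// mulr1 /tilt.
  rewrite (_ : _ - _ - _ = - (sqnorm theta / 2) + (r * dot theta (dir R p x) - r ^+ 2 / 2)); last by ring.
  by rewrite expRD; ring.
- apply: cmeas_mul; first exact: cmeas_kap.
  apply: jmeas_integral => //; first exact: jmeas_ray.
  by move=> r x r0; exact: ray_ge0.
- move=> x; rewrite mule_ge0 ?lee_fin ?kap_ge0//; apply: integral_ge0 => r r0.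
  exact: ray_ge0.
- by rewrite lee_fin mulr_ge0 ?expR_ge0 ?exprn_ge0 ?normal_peak_ge0.
Qed.

(** Monotonicity of cosh on the nonnegative half line, from the factorisation (e^y - e^x)(1 -
    e^(-x-y)) >= 0. *)
Lemma le_expR_sym (x y : R) : 0 <= x -> x <= y ->
  expR x + expR (- x) <= expR y + expR (- y).
Proof.
move=> x0 xy.
have h : 0 <= (expR y - expR x) * (1 - expR (- x - y)).
  by rewrite mulr_ge0// subr_ge0 ?ler_expR// -[leRHS]expR0 ler_expR; lra.
have e1 : expR y * expR (- x - y) = expR (- x) by rewrite -expRD; congr expR; ring.
have e2 : expR x * expR (- x - y) = expR (- y) by rewrite -expRD; congr expR; ring.
have : (expR y - expR x) * (1 - expR (- x - y)) =
    expR y - expR x - expR y * expR (- x - y) + expR x * expR (- x - y) by ring.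
by rewrite e1 e2 => e; rewrite e in h; lra.
Qed.

Lemma kapN x : kap R p (- x) = kap R p x.
Proof.
have sqN : sqnorm (- x) = sqnorm x by rewrite -scaleN1r sqnormZ sqrrN expr1n mul1r.
by rewrite /kap /enorm sqN.
Qed.

Lemma dirN x : dir R p (- x) = - dir R p x.
Proof.
have sqN : sqnorm (- x) = sqnorm x by rewrite -scaleN1r sqnormZ sqrrN expr1n mul1r.
by rewrite /dir /enorm sqN scalerN.
Qed.

(** Up to a factor free of [r], the normalised Bessel factor in the noncentral chi density of |X|.
    Left as an integral, since the proof uses only its monotonicity and its growth. *)
Definition mass (theta : V) (r : R) : \bar R :=
  leb R p (fun x => (kap R p x * expR (r * dot theta (dir R p x)))%:E).

Lemma jmeas_mass theta :
  jmeas R p (fun r x => (kap R p x * expR (r * dot theta (dir R p x)))%:E).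
Proof.
move=> d T u c mu0 mc; apply/measurable_EFinP.
apply: measurable_funM; first exact: measurable_kap.
apply: measurableT_comp => //; apply: measurable_funM => //.
by apply: measurable_dot; exact: measurable_dir.
Qed.

Lemma mass_term_ge0 theta r x : (0 <= (kap R p x * expR (r * dot theta (dir R p x)))%:E)%E.
Proof. by rewrite lee_fin mulr_ge0 ?kap_ge0 ?expR_ge0. Qed.

Lemma mass_ge0 theta r : (0 <= mass theta r)%E.
Proof. by apply: leb_iter_ge0 => x; exact: mass_term_ge0. Qed.

Lemma measurable_mass theta : measurable_fun setT (mass theta).
Proof.
apply: (jmeas_leb_iter R p (enum 'I_p) _ (jmeas_mass theta) _ _ _ id (fun=> 0)) => //.
by move=> u x; exact: mass_term_ge0.
Qed.

(* Averaging over x and -x makes the tilt symmetric, hence monotone in r. *)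
Lemma mass_sym theta r : mass theta r =
  leb R p (fun x => (kap R p x * ((expR (r * dot theta (dir R p x)) +
     expR (- (r * dot theta (dir R p x)))) / 2))%:E).
Proof.
pose F x : \bar R := (kap R p x * expR (r * dot theta (dir R p x)))%:E.
have mF : cmeas R p F := jmeasW R p _ r (jmeas_mass theta).
have F0 x : (0 <= F x)%E by exact: mass_term_ge0.
have mFN : cmeas R p (fun x => F (- x)).
  move=> d T u c mu0 mc; apply: (cmeas_measurable _ _ F _ _ (fun t => - c t)) => // i.
  rewrite (_ : (fun t => _) = (fun t => - c t 0 i)); last by apply/funext => t; rewrite mxE.
  exact: measurable_funN.
have mZ (G : V -> \bar R) : cmeas R p G -> cmeas R p (fun x => (2^-1)%:E * G x)%E.
  by apply: (cmeas_mul R p (fun=> (2^-1)%:E)) => d T u c mu0 mc; exact: measurable_cst.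
transitivity (leb R p (fun x => (2^-1)%:E * F x + (2^-1)%:E * F (- x)%R)%E).
  rewrite /leb leb_iterD//; [|exact: mZ|exact: mZ| |].
  - rewrite -/(leb R p _) -/(leb R p _) !lebZl// -leb_opp//.
    by rewrite -ge0_muleDl ?lee_fin// -EFinD (_ : 2^-1 + 2^-1 = 1) ?mul1e//; field.
  - by move=> x; rewrite mule_ge0// lee_fin.
  - by move=> x; rewrite mule_ge0// lee_fin.
congr (leb _ _ _); apply/funext => x; rewrite /F -!EFinM -EFinD; congr EFin.
by rewrite kapN dirN dotNr mulrN; field.
Qed.

Lemma mass_nd theta r s : 0 <= r -> r <= s -> (mass theta r <= mass theta s)%E.
Proof.
move=> r0 rs.
have mS t : cmeas R p (fun x => (kap R p x * ((expR (t * dot theta (dir R p x)) +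
     expR (- (t * dot theta (dir R p x)))) / 2))%:E).
  move=> d T u c mu0 mc; apply/measurable_EFinP.
  apply: measurable_funM; first exact: measurable_kap.
  apply: measurable_funM => //.
  have md : measurable_fun setT (fun z => t * dot theta (dir R p (c z))).
    by apply: measurable_funM => //; apply: measurable_dot; exact: measurable_dir.
  by apply: measurable_funD; apply: measurableT_comp => //; exact: measurable_funN.
rewrite !mass_sym; apply: le_leb_iter; [exact: mS|exact: mS| |] => x; rewrite lee_fin.
  by rewrite mulr_ge0 ?kap_ge0// divr_ge0// addr_ge0 ?expR_ge0.
rewrite ler_wpM2l ?kap_ge0// ler_pM2r//.
(* cosh is even, so the sign of theta.x may be dropped before monotonicity is applied. *)
have sym z : expR z + expR (- z) = expR `|z| + expR (- `|z|).
  by case: (ger0P z) => // _; rewrite opprK addrC.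
rewrite sym [leRHS]sym; apply: le_expR_sym => //.
by rewrite !normrM ler_wpM2r// !ger0_norm// (le_trans r0).
Qed.

Lemma mass_le theta r : 0 <= r ->
  (mass theta r <= (expR (r * \sum_i `|theta 0 i|))%:E * leb R p (fun x => (kap R p x)%:E))%E.
Proof.
move=> r0; rewrite -lebZl; [|exact: cmeas_kap| |]; last 2 first.
- by move=> x; rewrite lee_fin kap_ge0.
- by rewrite lee_fin expR_ge0.
apply: le_leb_iter.
- exact: jmeasW (jmeas_mass theta).
- apply: (cmeas_mul R p (fun=> (expR _)%:E)); last exact: cmeas_kap.
  by move=> d T u c mu0 mc; exact: measurable_cst.
- by move=> x; exact: mass_term_ge0.
move=> x; rewrite -EFinM lee_fin mulrC ler_wpM2r ?kap_ge0// ler_expR.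
by rewrite ler_wpM2l// dot_dir_le.
Qed.

Lemma mass0l r : mass 0 r = leb R p (fun x => (kap R p x)%:E).
Proof.
by congr (leb _ _ _); apply/funext => x; rewrite dot0l mulr0 expR0 mulr1.
Qed.

(** [tilt] with parameter b is [tilt] with parameter 0 times exp(r b); for a radial [h] only the
    last factor sees the direction, and integrating it against [kap] gives [mass]. *)
Lemma leb_radial theta (h : R -> R) n : measurable_fun setT h -> (forall r, 0 <= h r) ->
  (leb R p (fun x => (kap R p x)%:E * \int[mu]_(r in `]0%R, +oo[)
     (r ^+ n * tilt R (dot theta (dir R p x)) r * h r)%:E) =
   \int[mu]_(r in `]0%R, +oo[) ((r ^+ n * tilt R 0 r * h r)%:E * mass theta r))%E.
Proof.
move=> mh h0.
pose w r := r ^+ n * tilt R 0 r * h r.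
have mw : measurable_fun setT w.
  by apply: measurable_funM => //; exact: measurable_monomial_tilt.
have w0 r : 0 < r -> 0 <= w r.
  move=> r0; rewrite mulr_ge0// mulr_ge0 ?(ltW (tilt_gt0 _ _ _))//.
  by rewrite exprn_ge0// ltW.
pose f r x : \bar R := ((w r)%:E * (kap R p x * expR (r * dot theta (dir R p x)))%:E)%E.
transitivity (leb R p (fun x => \int[mu]_(r in `]0%R, +oo[) f r x)%E).
  congr (leb _ _ _); apply/funext => x; rewrite -ge0_integralZl//.
  - apply: eq_integral => r _; rewrite /f /w -!EFinM; congr EFin.
    rewrite /tilt mulr0 sub0r addrC expRD; ring.
  - apply/measurable_EFinP; apply: measurable_funTS; apply: measurable_funM => //.
    exact: measurable_monomial_tilt.
  - move=> r /=; rewrite in_itv/= andbT => r0; rewrite lee_fin mulr_ge0//.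
    by rewrite mulr_ge0 ?(ltW (tilt_gt0 _ _ _))// exprn_ge0// ltW.
  - by rewrite lee_fin kap_ge0.
rewrite (leb_tonelli _ _ _ f)//.
- apply: eq_integral => r; rewrite inE/= in_itv/= andbT => r0.
  rewrite /f lebZl ?lee_fin ?w0//; first exact: jmeasW (jmeas_mass theta).
  by move=> x; exact: mass_term_ge0.
- move=> d T u c mu0 mc; apply: emeasurable_funM; last exact: jmeas_mass.
  by apply/measurable_EFinP; exact: (measurableT_comp mw).
- move=> r x /=; rewrite in_itv/= andbT => r0.
  by rewrite mule_ge0 ?mass_term_ge0// lee_fin w0.
Qed.

End gaussian.

(** * The profile G and Stein's identity on a ray *)

Section profile.
Variables (R : realType) (Phi : R -> R) (C : R).
Local Notation mu := (@lebesgue_measure R).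
Hypotheses (C_gt0 : 0 < C) (Phi_nd : {homo Phi : x y / x <= y})
  (Phi_ge0 : forall t, 0 <= Phi t)
  (Phi_int : forall w, 0 < w ->
     (\int[mu]_(t in `]0%R, w]%classic) (Phi t / t)%:E < +oo)%E).

Definition cumul (w : R) : R :=
  fine (\int[mu]_(t in `]0%R, w]%classic) (Phi t / t)%:E)%E.

(** The function G of the overview, in the variable r = |x| instead of w = r^2. *)
Definition gain (r : R) : R := (cumul (r ^+ 2) + C)^-1.

(** Minus the derivative of [gain] at every r > 0 where Phi is continuous at r^2; the factor 2 comes
    from the chain rule for w = r^2. *)
Definition gain_rate (r : R) : R := 2 * gain r ^+ 2 * Phi (r ^+ 2) / r.

Lemma measurable_Phi : measurable_fun setT Phi.
Proof. exact: nondecreasing_measurable. Qed.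

Let measurable_Phidiv : measurable_fun setT (fun t => (Phi t / t)%:E).
Proof.
apply/measurable_EFinP; apply: measurable_funM; first exact: measurable_Phi.
exact: measurable_inv.
Qed.

Let Phidiv_ge0 t : 0 < t -> (0 <= (Phi t / t)%:E)%E.
Proof. by move=> t0; rewrite lee_fin divr_ge0// ltW. Qed.

Lemma cumul_fin w : (\int[mu]_(t in `]0%R, w]%classic) (Phi t / t)%:E \is a fin_num)%E.
Proof.
have [w0|w0] := leP w 0.
  by rewrite set_itv_ge ?integral_set0// bnd_simp -leNgt.
rewrite ge0_fin_numE ?Phi_int//; apply: integral_ge0 => t.
by rewrite /= in_itv/= => /andP[t0 _]; exact: Phidiv_ge0.
Qed.

Lemma cumul_ge0 w : 0 <= cumul w.
Proof.
apply: fine_ge0; apply: integral_ge0 => t.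
by rewrite /= in_itv/= => /andP[t0 _]; exact: Phidiv_ge0.
Qed.

Lemma cumul_nd : {homo cumul : x y / x <= y}.
Proof.
move=> x y xy; apply: fine_le; rewrite ?cumul_fin//.
apply: ge0_subset_integral => //.
- exact: measurable_funTS.
- by move=> t; rewrite /= in_itv/= => /andP[t0 _]; exact: Phidiv_ge0.
- by move=> t; rewrite /= !in_itv/= => /andP[-> /le_trans]; apply.
Qed.

Lemma cumul_incr x y : 0 < x -> x <= y ->
  ((cumul y - cumul x)%:E = \int[mu]_(t in `]x, y]) (Phi t / t)%:E)%E.
Proof.
move=> x0 xy; rewrite /cumul EFinB !fineK ?cumul_fin//.
rewrite (ge0_integral_itvU _ _ 0 x y) ?(ltW x0)//.
by rewrite addeAC subee ?cumul_fin// add0e.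
Qed.

Lemma measurable_cumul : measurable_fun setT cumul.
Proof. by apply: nondecreasing_measurable => //; exact: cumul_nd. Qed.

Lemma measurable_gain : measurable_fun setT gain.
Proof.
apply: measurable_funV; apply: measurable_funD => //.
by apply: (@measurableT_comp _ _ _ _ _ _ cumul) => //; exact: measurable_cumul.
Qed.

Lemma gain_gt0 r : 0 < gain r.
Proof. by rewrite invr_gt0 ltr_wpDl// cumul_ge0. Qed.

Lemma gain_le r : gain r <= C^-1.
Proof. by rewrite lef_pV2 ?posrE ?ltr_wpDl ?cumul_ge0// lerDr cumul_ge0. Qed.

Lemma gain_ni x y : 0 <= x -> x <= y -> gain y <= gain x.
Proof.
move=> x0 xy; rewrite lef_pV2 ?posrE ?ltr_wpDl ?cumul_ge0// lerD2r.
by apply: cumul_nd; rewrite lerXn2r ?nnegrE//; exact: le_trans xy.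
Qed.

Lemma measurable_gain_rate : measurable_fun setT gain_rate.
Proof.
apply: measurable_funM; last exact: measurable_inv.
apply: measurable_funM.
  by apply: measurable_funM => //; apply: measurable_funX; exact: measurable_gain.
by apply: (@measurableT_comp _ _ _ _ _ _ Phi) => //; exact: measurable_Phi.
Qed.

Lemma gain_rate_ge0 r : 0 < r -> 0 <= gain_rate r.
Proof. by move=> r0; rewrite divr_ge0 ?(ltW r0)// !mulr_ge0// ltW// gain_gt0. Qed.

(** [gain] decreases and Phi increases, so the numerator of the rate lies between the two mixed
    products of endpoint values. *)
Lemma gain_rate_bounds x y : 0 < x -> x <= y ->
  ((2 * gain y ^+ 2 * Phi (x ^+ 2) * (ln y - ln x))%:E <= \int[mu]_(t in `]x, y]) (gain_rate t)%:E <=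
   (2 * gain x ^+ 2 * Phi (y ^+ 2) * (ln y - ln x))%:E)%E.
Proof.
move=> x0 xy; apply: (integral_divr_bounds _ (fun r => 2 * gain r ^+ 2 * Phi (r ^+ 2))) => //.
- apply: measurable_funM.
    by apply: measurable_funM => //; apply: measurable_funX; exact: measurable_gain.
  by apply: (@measurableT_comp _ _ _ _ _ _ Phi) => //; exact: measurable_Phi.
- by rewrite !mulr_ge0// ltW// gain_gt0.
- have E u v : 2 * u * v = 2 * (u * v) :> R by rewrite mulrA.
  move=> t xt ty; rewrite !E !ler_pM2l//; apply/andP; split; apply: ler_pM => //.
  + exact: sqr_ge0.
  + by rewrite lerXn2r ?nnegrE ?(ltW (gain_gt0 _))// gain_ni//; lra.
  + by apply: Phi_nd; rewrite lerXn2r ?nnegrE//; lra.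
  + exact: sqr_ge0.
  + by rewrite lerXn2r ?nnegrE ?(ltW (gain_gt0 _))// gain_ni//; lra.
  + by apply: Phi_nd; rewrite lerXn2r ?nnegrE//; lra.
Qed.

(** The bounds coincide with those of [gain_rate_bounds]; hence the increment of [gain] and the
    integral of the rate differ by at most the gap between them. *)
Lemma gain_incr_bounds x y : 0 < x -> x <= y ->
  2 * gain y ^+ 2 * Phi (x ^+ 2) * (ln y - ln x) <= gain x - gain y <=
  2 * gain x ^+ 2 * Phi (y ^+ 2) * (ln y - ln x).
Proof.
move=> x0 xy; set l := ln y - ln x; have y0 : 0 < y by exact: lt_le_trans xy.
have x20 : 0 < x ^+ 2 by rewrite exprn_gt0.
have xy2 : x ^+ 2 <= y ^+ 2 by rewrite lerXn2r ?nnegrE//; lra.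
have := integral_divr_bounds _ Phi (x ^+ 2) (y ^+ 2) (Phi (x ^+ 2)) (Phi (y ^+ 2)) x20 xy2 measurable_Phi (Phi_ge0 _).
rewrite -cumul_incr// !lee_fin !lnXn// => /(_ _)/wrap[].
  by move=> t xt ty; rewrite !Phi_nd// ltW.
have -> : ln y *+ 2 - ln x *+ 2 = 2 * l by rewrite /l; ring.
have l0 : 0 <= l by rewrite subr_ge0 ler_ln.
have gx := ltW (gain_gt0 x); have gy := ltW (gain_gt0 y).
have gxy : gain y <= gain x by rewrite gain_ni// ltW.
(* 1/A - 1/B = (B - A)/(A B) turns the increment of [gain] into one of [cumul], whose logarithm over
   ]x^2, y^2] is 2 [l]. *)
have -> : gain x - gain y = gain x * gain y * (cumul (y ^+ 2) - cumul (x ^+ 2)).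
  have := cumul_ge0 (x ^+ 2); have := cumul_ge0 (y ^+ 2).
  by rewrite /gain => h1 h2; field; rewrite !gt_eqF// ltr_wpDl.
move=> /andP[h1 h2]; apply/andP; split.
  have -> : 2 * gain y ^+ 2 * Phi (x ^+ 2) * l = gain y * gain y * (Phi (x ^+ 2) * (2 * l)) by ring.
  by apply: ler_pM; rewrite ?mulr_ge0 ?ler_pM.
have -> : 2 * gain x ^+ 2 * Phi (y ^+ 2) * l = gain x * gain x * (Phi (y ^+ 2) * (2 * l)) by ring.
by apply: ler_pM; rewrite ?mulr_ge0 ?ler_pM// subr_ge0 cumul_nd.
Qed.

Lemma gain_rate_fin x y : 0 < x -> x <= y ->
  (\int[mu]_(t in `]x, y]) (gain_rate t)%:E \is a fin_num)%E.
Proof.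
move=> x0 xy; have /andP[_ h] := gain_rate_bounds x y x0 xy.
rewrite ge0_fin_numE ?(le_lt_trans h) ?ltry//.
apply: integral_ge0 => t; rewrite /= in_itv/= => /andP[xt _].
by rewrite lee_fin gain_rate_ge0// (lt_trans x0).
Qed.

(** [gain] plus the integral of its rate has increments of second order on short intervals, with a
    total controlled by a monotone function, so it is constant. *)
Lemma gain_incr x y : 0 < x -> x <= y ->
  ((gain x - gain y)%:E = \int[mu]_(t in `]x, y]) (gain_rate t)%:E)%E.
Proof.
move=> x0 xy.
pose cum z := fine (\int[mu]_(t in `]x, z]) (gain_rate t)%:E)%E.
pose D z := gain z + cum z.
suff : D y = D x.
  rewrite /D {2}/cum set_itvoc0 integral_set0 addr0 => <-.
  by rewrite addrAC subrr add0r fineK// gain_rate_fin.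
(* On [x, y] the oscillation gain(u)^2 Phi(v^2) - gain(v)^2 Phi(u^2) splits into an increment of Phi
   times gain(u)^2 and an increment of - gain^2 times Phi(u^2). Replacing these weights by their
   maxima gives at most V(v) - V(u). *)
pose V z := gain x ^+ 2 * Phi (z ^+ 2) - Phi (y ^+ 2) * gain z ^+ 2.
(* The 2 is that of the rate; 1/x comes from ln v - ln u <= (v - u)/u <= (v - u)/x. *)
apply: (small_increments_const _ D V _ _ (2 / x) xy) => u v xu uv vy.
have u0 : 0 < u by exact: lt_le_trans xu.
have v0 : 0 < v by exact: lt_le_trans uv.
have -> : D v - D u = fine (\int[mu]_(t in `]u, v]) (gain_rate t)%:E)%E - (gain u - gain v).
  rewrite /D /cum (ge0_integral_itvU _ _ x u v)//.
  - by rewrite fineD ?gain_rate_fin//; ring.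
  - by apply/measurable_EFinP; exact: measurable_gain_rate.
  - by move=> t xt; rewrite lee_fin gain_rate_ge0// (lt_trans x0).
have := gain_incr_bounds u v u0 uv; have := gain_rate_bounds u v u0 uv.
rewrite -[X in (_ <= X <= _)%E]fineK ?gain_rate_fin// !lee_fin.
set J := fine _; set l := ln v - ln u.
have l0 : 0 <= l by rewrite subr_ge0 ler_ln.
have lv : l <= x^-1 * (v - u).
  rewrite /l -ln_div ?posrE//.
  have -> : v / u = 1 + (v / u - 1) by ring.
  apply: le_trans (le_ln1Dx _) _.
    by rewrite -subr_gt0 opprK subrK divr_gt0.
  have -> : v / u - 1 = u^-1 * (v - u) by field; rewrite gt_eqF.
  by rewrite ler_wpM2r ?subr_ge0// lef_pV2.
have gv : 0 <= gain v ^+ 2 by exact: sqr_ge0.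
have gvu : gain v ^+ 2 <= gain u ^+ 2.
  by rewrite lerXn2r ?nnegrE ?(ltW (gain_gt0 _))// gain_ni// ltW.
have gux : gain u ^+ 2 <= gain x ^+ 2.
  by rewrite lerXn2r ?nnegrE ?(ltW (gain_gt0 _))// gain_ni// ltW.
have Puv : Phi (u ^+ 2) <= Phi (v ^+ 2).
  by apply: Phi_nd; rewrite lerXn2r ?nnegrE//; lra.
have Puy : Phi (u ^+ 2) <= Phi (y ^+ 2).
  by apply: Phi_nd; rewrite lerXn2r ?nnegrE//; lra.
move=> /andP[h1 h2] /andP[h3 h4].
have hV : gain u ^+ 2 * Phi (v ^+ 2) - gain v ^+ 2 * Phi (u ^+ 2) <= V v - V u.
  have a1 : 0 <= (gain x ^+ 2 - gain u ^+ 2) * (Phi (v ^+ 2) - Phi (u ^+ 2)).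
    by rewrite mulr_ge0// subr_ge0.
  have a2 : 0 <= (Phi (y ^+ 2) - Phi (u ^+ 2)) * (gain u ^+ 2 - gain v ^+ 2).
    by rewrite mulr_ge0// subr_ge0.
  rewrite /V; lra.
have hV0 : 0 <= gain u ^+ 2 * Phi (v ^+ 2) - gain v ^+ 2 * Phi (u ^+ 2).
  by rewrite subr_ge0 ler_pM.
have := ler_pM hV0 l0 hV lv; rewrite ler_norml; move: h1 h2 h3 h4 => /=.
move: (Phi (u ^+ 2)) (Phi (v ^+ 2)) (gain u ^+ 2) (gain v ^+ 2) (V v) (V u) => ? ? ? ? ? ?.
by move=> ? ? ? ? ?; apply/andP; split; lra.
Qed.

(** [g0] is the limit of [gain] at infinity. Its value is left open because its contributions in
    [gain_by_parts] match: [tilt_up] and [tilt_down] have equal integrals. *)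
Lemma gain_tail : exists2 g0, 0 <= g0 & forall r, 0 < r ->
  ((gain r)%:E = g0%:E + \int[mu]_(s in `]r, +oo[) (gain_rate s)%:E)%E.
Proof.
pose u (n : nat) := gain n%:R.
have u_ni : nonincreasing_seq u by move=> m n mn; apply: gain_ni => //; rewrite ler_nat.
have u_lb : has_lbound (range u).
  by exists 0 => _ [n _ <-]; rewrite ltW// gain_gt0.
have u_cvg := nonincreasing_is_cvgn u_ni u_lb.
exists (limn u).
  by apply: limr_ge => //; apply: nearW => n; rewrite ltW// gain_gt0.
move=> r r0.
have mr : measurable_fun setT (fun s => (gain_rate s)%:E).
  by apply/measurable_EFinP; exact: measurable_gain_rate.
have c1 : (fun n : nat => \int[mu]_(s in `]r, n%:R]) (gain_rate s)%:E)%E @ \oo -->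
    (\int[mu]_(s in `]r, +oo[) (gain_rate s)%:E)%E.
  have -> : `]r, +oo[%classic = \bigcup_n `]r, n%:R]%classic :> set R.
    apply/seteqP; split => s /=; rewrite in_itv/= ?andbT => s0.
      exists (Num.truncn s).+1 => //=; rewrite in_itv/= s0 ltW// truncnS_gt//.
    by case: s0 => n _ /=; rewrite in_itv/= => /andP[].
  apply: ge0_nondecreasing_set_cvg_integral => //.
  - move=> m n mn; rewrite subsetEset => s /=; rewrite !in_itv/= => /andP[-> h].
    by rewrite (le_trans h)// ler_nat.
  - by move=> n; exact: measurable_funTS.
  - move=> n s /=; rewrite in_itv/= => /andP[rs _].
    by rewrite lee_fin gain_rate_ge0// (lt_trans r0).
have c2 : (fun n : nat => (gain r - u n)%:E) @ \oo --> (gain r - limn u)%:E.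
  by apply: cvg_EFin; [exact: nearW|apply: cvgB => //; exact: cvg_cst].
have -> : (\int[mu]_(s in `]r, +oo[) (gain_rate s)%:E = (gain r - limn u)%:E)%E.
  apply: (cvg_unique _ c1) => //; apply: cvg_trans c2; apply: near_eq_cvg; near=> n.
  rewrite /= gain_incr//; near: n; exact: nbhs_infty_ger.
by rewrite -EFinD addrC subrK.
Unshelve. all: by end_near. Qed.

(** Write [gain] as a constant plus the tail integral of its rate and exchange the order of
    integration. The inner integral over ]0, s[ is then exact: [tilt_up] exceeds [tilt_down] by the
    boundary term at s. *)
Lemma gain_by_parts (b : R) q :
  (\int[mu]_(r in `]0%R, +oo[) (gain r * tilt_up R b q r)%:E =
   \int[mu]_(r in `]0%R, +oo[) (gain r * tilt_down R b q r)%:E +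
   \int[mu]_(r in `]0%R, +oo[) (gain_rate r * (r ^+ q.+1 * tilt R b r))%:E)%E.
Proof.
have [g0 g00 tail] := gain_tail.
have mgr : measurable_fun setT (fun s => (gain_rate s)%:E).
  by apply/measurable_EFinP; exact: measurable_gain_rate.
have main (m : R -> R) : measurable_fun setT m -> (forall r, 0 < r -> 0 <= m r) ->
    (\int[mu]_(r in `]0%R, +oo[) (gain r * m r)%:E =
     g0%:E * \int[mu]_(r in `]0%R, +oo[) (m r)%:E +
     \int[mu]_(s in `]0%R, +oo[) ((gain_rate s)%:E * \int[mu]_(r in `]0%R, s[) (m r)%:E))%E.
  move=> mm m0.
  rewrite -tonelli_triangle//; [|exact: measurable_gain_rate|exact: gain_rate_ge0].
  have mm' : measurable_fun (`]0%R, +oo[%classic : set R) (EFin \o m).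
    by apply/measurable_EFinP; exact: measurable_funTS.
  rewrite -ge0_integralZl//; last first.
    by move=> r /=; rewrite in_itv/= andbT => r0; rewrite lee_fin m0.
  have tailE r : 0 < r -> (\int[mu]_(s in `]r, +oo[) (gain_rate s)%:E = (gain r - g0)%:E)%E.
    by move=> r0; rewrite EFinB tail// addeAC subee// add0e.
  have tail0 r : 0 < r -> 0 <= gain r - g0.
    move=> r0; rewrite -lee_fin -tailE//; apply: integral_ge0 => s /=.
    by rewrite in_itv/= andbT => rs; rewrite lee_fin gain_rate_ge0// (lt_trans r0).
  rewrite [X in (_ = _ + X)%E](_ : _ = \int[mu]_(r in `]0%R, +oo[) ((m r)%:E * (gain r - g0)%:E))%E; last first.
    by apply: eq_integral => r; rewrite inE/= in_itv/= andbT => r0; rewrite tailE.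
  rewrite -ge0_integralD//.
  - by apply: eq_integral => r _; rewrite -!EFinM -EFinD; congr EFin; ring.
  - by move=> r /=; rewrite in_itv/= andbT => r0; rewrite lee_fin mulr_ge0// m0.
  - exact: emeasurable_funM.
  - by move=> r /=; rewrite in_itv/= andbT => r0; rewrite lee_fin mulr_ge0 ?m0 ?tail0.
  - apply/measurable_EFinP; apply: measurable_funTS; apply: measurable_funM => //.
    by apply: measurable_funB => //; exact: measurable_gain.
rewrite main; [|exact: measurable_tilt_up|by move=> r r0; rewrite tilt_up_ge0// ltW].
rewrite main; [|exact: measurable_tilt_down|by move=> r r0; rewrite tilt_down_ge0// ltW].
rewrite integral_tilt_up_oo -addeA; congr (_ + _)%E.
rewrite -ge0_integralD//.
- apply: eq_integral => s; rewrite inE/= in_itv/= andbT => s0.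
  rewrite integral_tilt_up// ge0_muleDr//.
    apply: integral_ge0 => r /=; rewrite in_itv/= => /andP[r0 _].
    by rewrite lee_fin tilt_down_ge0// ltW.
  by rewrite lee_fin mulr_ge0 ?exprn_ge0 ?(ltW (tilt_gt0 _ _ _))// ltW.
- move=> s /=; rewrite in_itv/= andbT => s0; rewrite mule_ge0//.
    by rewrite lee_fin gain_rate_ge0.
  apply: integral_ge0 => r /=; rewrite in_itv/= => /andP[r0 _].
  by rewrite lee_fin tilt_down_ge0// ltW.
- apply: emeasurable_funM; first exact: measurable_funTS.
  apply: measurable_funTS; apply: measurable_integral_lt; first exact: measurable_tilt_down.
  by move=> r r0; rewrite tilt_down_ge0// ltW.
- move=> s /=; rewrite in_itv/= andbT => s0.
  by rewrite lee_fin mulr_ge0 ?gain_rate_ge0// mulr_ge0 ?exprn_ge0 ?(ltW (tilt_gt0 _ _ _))// ltW.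
- apply/measurable_EFinP; apply: measurable_funTS; apply: measurable_funM => //.
    exact: measurable_gain_rate.
  exact: measurable_monomial_tilt.
Qed.

(** The two parts of G^2 (4 Phi - 1) stay on opposite sides of the identities. The factor 1/w is
    absorbed in the power of r, which drops from p - 1 to p - 3. *)
Definition pos_part (r : R) : R := gain r ^+ 2 * Num.max (4 * Phi (r ^+ 2) - 1) 0.

Definition neg_part (r : R) : R := gain r ^+ 2 * Num.max (1 - 4 * Phi (r ^+ 2)) 0.

Lemma pos_part_ge0 r : 0 <= pos_part r.
Proof. by rewrite mulr_ge0 ?sqr_ge0// le_max lexx orbT. Qed.

Lemma neg_part_ge0 r : 0 <= neg_part r.
Proof. by rewrite mulr_ge0 ?sqr_ge0// le_max lexx orbT. Qed.

Lemma neg_part_le r : neg_part r <= C^-1 ^+ 2.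
Proof.
rewrite -[leRHS]mulr1 ler_pM ?sqr_ge0// ?le_max ?lexx ?orbT//.
  by rewrite lerXn2r ?nnegrE ?(ltW (gain_gt0 _)) ?gain_le// ltW// invr_gt0.
by rewrite ge_max ler01 andbT gerBl mulr_ge0.
Qed.

Let measurable_Phi2 : measurable_fun setT (fun r : R => 4 * Phi (r ^+ 2)).
Proof.
apply: measurable_funM => //.
by apply: (@measurableT_comp _ _ _ _ _ _ Phi) => //; exact: measurable_Phi.
Qed.

Lemma measurable_pos_part : measurable_fun setT pos_part.
Proof.
apply: measurable_funM; first by apply: measurable_funX; exact: measurable_gain.
by apply: measurable_maxr => //; exact: measurable_funB.
Qed.

Lemma measurable_neg_part : measurable_fun setT neg_part.
Proof.
apply: measurable_funM; first by apply: measurable_funX; exact: measurable_gain.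
by apply: measurable_maxr => //; exact: measurable_funB.
Qed.

Lemma part_sub r : pos_part r - neg_part r = gain r ^+ 2 * (4 * Phi (r ^+ 2) - 1).
Proof.
rewrite /pos_part /neg_part -mulrBr; congr (_ * _).
by case: (leP (4 * Phi (r ^+ 2)) 1) => h; [rewrite max_r ?max_l|rewrite max_l ?max_r]; lra.
Qed.

(** This finiteness permits the cancellation in [ray_identity]. *)
Lemma gain_up_int (b : R) q :
  (\int[mu]_(r in `]0%R, +oo[) (gain r * tilt_up R b q r)%:E < +oo)%E.
Proof.
apply: (@le_lt_trans _ _ (\int[mu]_(r in `]0%R, +oo[) (C^-1%:E * (tilt_up R b q r)%:E))%E).
  apply: ge0_le_integral => //.
  - move=> r /=; rewrite in_itv/= andbT => r0.
    by rewrite lee_fin mulr_ge0 ?tilt_up_ge0 ?(ltW (gain_gt0 _))// ltW.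
  - apply/measurable_EFinP; apply: measurable_funTS.
    by apply: measurable_funM; [exact: measurable_gain|exact: measurable_tilt_up].
  - apply/measurable_EFinP; apply: measurable_funTS.
    by apply: measurable_funM => //; exact: measurable_tilt_up.
  - move=> r /=; rewrite in_itv/= andbT => r0.
    by rewrite -EFinM lee_fin ler_wpM2r ?gain_le// tilt_up_ge0// ltW.
have mt n : measurable_fun (`]0%R, +oo[%classic : set R) (fun r : R => (r ^+ n * tilt R b r)%:E).
  by apply/measurable_EFinP; apply: measurable_funTS; exact: measurable_monomial_tilt.
have t0 n r : (`]0%R, +oo[%classic : set R) r -> (0 <= (r ^+ n * tilt R b r)%:E)%E.
  rewrite /= in_itv/= andbT => r0.
  by rewrite lee_fin mulr_ge0 ?(ltW (tilt_gt0 _ _ _))// exprn_ge0// ltW.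
have b0 : 0 <= `|b| + b by have := ler_norm (- b); rewrite normrN; lra.
rewrite ge0_integralZl//; last 3 first.
- by apply/measurable_EFinP; apply: measurable_funTS; exact: measurable_tilt_up.
- by move=> r /=; rewrite in_itv/= andbT => r0; rewrite lee_fin tilt_up_ge0// ltW.
- by rewrite lee_fin ltW// invr_gt0.
apply: lte_mul_pinfty => //; first by rewrite lee_fin ltW// invr_gt0.
have upE r : ((tilt_up R b q r)%:E = q.+1%:R%:E * (r ^+ q * tilt R b r)%:E +
    (`|b| + b)%:E * (r ^+ q.+1 * tilt R b r)%:E)%E by [].
under eq_integral do rewrite upE.
rewrite ge0_integralD//; last 4 first.
- by move=> r r0; rewrite mule_ge0// ?lee_fin//; exact: t0.
- by apply: emeasurable_funM => //; exact: mt.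
- by move=> r r0; rewrite mule_ge0// ?lee_fin//; exact: t0.
- by apply: emeasurable_funM => //; exact: mt.
rewrite !ge0_integralZl// ?lee_fin//.
- by rewrite lte_add_pinfty// lte_mul_pinfty// ?lee_fin//; exact: monomial_tilt_int.
- exact: mt.
- exact: t0.
- exact: mt.
- exact: t0.
Qed.

(* Stein's identity along a ray: the first-order terms of the loss difference
   are 2 gain (tilt_up - tilt_down), which gain_by_parts trades for gain_rate. *)
Lemma ray_identity (b T : R) q (lphi ljs : R -> R) :
  measurable_fun setT lphi -> measurable_fun setT ljs ->
  (forall r, 0 <= lphi r) -> (forall r, 0 <= ljs r) ->
  (forall r, 0 < r -> lphi r = (r - (q.+1%:R - gain r) / r) ^+ 2 -
      2 * b * (r - (q.+1%:R - gain r) / r) + T) ->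
  (forall r, 0 < r -> ljs r = (r - q.+1%:R / r) ^+ 2 - 2 * b * (r - q.+1%:R / r) + T) ->
  (\int[mu]_(r in `]0%R, +oo[) (r ^+ q.+2 * tilt R b r * lphi r)%:E +
   \int[mu]_(r in `]0%R, +oo[) (r ^+ q * tilt R b r * pos_part r)%:E =
   \int[mu]_(r in `]0%R, +oo[) (r ^+ q.+2 * tilt R b r * ljs r)%:E +
   \int[mu]_(r in `]0%R, +oo[) (r ^+ q * tilt R b r * neg_part r)%:E)%E.
Proof.
move=> mphi mjs phi0 js0 phiE jsE.
have mt n (f : R -> R) : measurable_fun setT f ->
    measurable_fun (`]0%R, +oo[%classic : set R) (fun r : R => (r ^+ n * tilt R b r * f r)%:E).
  move=> mf; apply/measurable_EFinP; apply: measurable_funTS; apply: measurable_funM => //.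
  exact: measurable_monomial_tilt.
have t0 n (f : R -> R) : (forall r, 0 <= f r) -> forall r, (`]0%R, +oo[%classic : set R) r ->
    (0 <= (r ^+ n * tilt R b r * f r)%:E)%E.
  move=> f0 r; rewrite /= in_itv/= andbT => r0.
  by rewrite lee_fin mulr_ge0// mulr_ge0 ?(ltW (tilt_gt0 _ _ _))// exprn_ge0// ltW.
have m2 (f g : R -> R) : measurable_fun setT f -> measurable_fun setT g ->
    measurable_fun (`]0%R, +oo[%classic : set R) (fun r : R => (f r * g r)%:E).
  by move=> mf mg; apply/measurable_EFinP; apply: measurable_funTS; exact: measurable_funM.
have mup : measurable_fun (`]0%R, +oo[%classic : set R) (fun r => (gain r * tilt_up R b q r)%:E).
  by apply: m2; [exact: measurable_gain|exact: measurable_tilt_up].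
have up0 r : (`]0%R, +oo[%classic : set R) r -> (0 <= (gain r * tilt_up R b q r)%:E)%E.
  rewrite /= in_itv/= andbT => r0.
  by rewrite lee_fin mulr_ge0 ?tilt_up_ge0 ?(ltW (gain_gt0 _))// ltW.
have mdown : measurable_fun (`]0%R, +oo[%classic : set R) (fun r => (gain r * tilt_down R b q r)%:E).
  by apply: m2; [exact: measurable_gain|exact: measurable_tilt_down].
have down0 r : (`]0%R, +oo[%classic : set R) r -> (0 <= (gain r * tilt_down R b q r)%:E)%E.
  rewrite /= in_itv/= andbT => r0.
  by rewrite lee_fin mulr_ge0 ?tilt_down_ge0 ?(ltW (gain_gt0 _))// ltW.
have mrate : measurable_fun (`]0%R, +oo[%classic : set R)
    (fun r => (gain_rate r * (r ^+ q.+1 * tilt R b r))%:E).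
  by apply: m2; [exact: measurable_gain_rate|exact: measurable_monomial_tilt].
have rate0 r : (`]0%R, +oo[%classic : set R) r ->
    (0 <= (gain_rate r * (r ^+ q.+1 * tilt R b r))%:E)%E.
  rewrite /= in_itv/= andbT => r0.
  by rewrite lee_fin mulr_ge0 ?gain_rate_ge0// mulr_ge0 ?(ltW (tilt_gt0 _ _ _))// exprn_ge0// ltW.
set A1 := (X in (X + _ = _)%E); set A2 := (X in (_ + X = _)%E).
set B1 := (X in (_ = X + _)%E); set B2 := (X in (_ = _ + X)%E).
set U := (\int[mu]_(r in `]0%R, +oo[) (gain r * tilt_up R b q r)%:E)%E.
have Ufin : U \is a fin_num.
  by rewrite ge0_fin_numE ?gain_up_int//; apply: integral_ge0.
(* Adding [U] twice compensates the first-order term - 2 G M'. Expanding the right-hand copies by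
   [gain_by_parts] makes the two integrands equal pointwise. *)
suff E : (A1 + A2 + (U + U) = B1 + B2 + (U + U))%E.
  have UU : (U + U)%E \is a fin_num by rewrite fin_numD Ufin.
  by rewrite -[LHS](@addeK _ (U + U)%E)// E addeK.
have UE := gain_by_parts b q; rewrite -/U in UE; rewrite [in RHS]UE /A1 /A2 /B1 /B2 /U.
pose D : set R := `]0%R, +oo[%classic; have mD : measurable D by exact: measurable_itv.
pose nn (f : R -> \bar R) := measurable_fun D f /\ forall r, D r -> (0 <= f r)%E.
have nnI f : measurable_fun D f -> (forall r, D r -> (0 <= f r)%E) -> nn f by [].
have nnD f g : nn f -> nn g -> nn (f \+ g)%E.
  move=> [mf f0] [mg g0]; split; first exact: emeasurable_funD.
  by move=> r Dr; rewrite adde_ge0// ?f0// g0.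
have intD f g : nn f -> nn g ->
    (\int[mu]_(r in D) f r + \int[mu]_(r in D) g r = \int[mu]_(r in D) (f \+ g) r)%E.
  by move=> [mf f0] [mg g0]; rewrite ge0_integralD.
have nA1 := nnI _ (mt q.+2 lphi mphi) (t0 q.+2 lphi phi0).
have nA2 := nnI _ (mt q pos_part measurable_pos_part) (t0 q pos_part pos_part_ge0).
have nB1 := nnI _ (mt q.+2 ljs mjs) (t0 q.+2 ljs js0).
have nB2 := nnI _ (mt q neg_part measurable_neg_part) (t0 q neg_part neg_part_ge0).
have nU := nnI _ mup up0; have nDn := nnI _ mdown down0; have nG := nnI _ mrate rate0.
rewrite (intD _ _ nA1 nA2) (intD _ _ nU nU) (intD _ _ (nnD _ _ nA1 nA2) (nnD _ _ nU nU)).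
rewrite (intD _ _ nB1 nB2) (intD _ _ nDn nG).
rewrite (intD _ _ (nnD _ _ nDn nG) (nnD _ _ nDn nG)).
rewrite (intD _ _ (nnD _ _ nB1 nB2) (nnD _ _ (nnD _ _ nDn nG) (nnD _ _ nDn nG))).
apply: eq_integral => r; rewrite inE /D/= in_itv/= andbT => r0.
rewrite -!EFinD; congr EFin; rewrite phiE// jsE//.
have -> : pos_part r = neg_part r + gain r ^+ 2 * (4 * Phi (r ^+ 2) - 1).
  by rewrite -part_sub addrC subrK.
rewrite /tilt_up /tilt_down /gain_rate !exprS; field.
by rewrite gt_eqF.
Qed.

(** * From rays to risks in dimension p = q + 3 *)

Section risk.
Variable q : nat.
Local Notation V := 'rV[R]_q.+3.

Lemma sqnormB_scale (w theta : V) (c : R) : sqnorm w = 1 ->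
  sqnorm (c *: w - theta) = c ^+ 2 - 2 * dot R q.+3 theta w * c + sqnorm theta.
Proof.
move=> w1.
have -> : c ^+ 2 - 2 * dot R q.+3 theta w * c + sqnorm theta =
    c ^+ 2 * sqnorm w + - (2 * c) * dot R q.+3 theta w + sqnorm theta by rewrite w1; ring.
rewrite /sqnorm /dot !mulr_sumr -!big_split/=; apply: eq_bigr => i _; rewrite !mxE; ring.
Qed.

Lemma loss_on_ray (phi : R -> R) (theta w : V) r : sqnorm w = 1 -> 0 < r ->
  sqnorm (shrink_est phi (r *: w) - theta) =
  (r - phi (r ^+ 2) / r) ^+ 2 - 2 * dot R q.+3 theta w * (r - phi (r ^+ 2) / r) + sqnorm theta.
Proof.
move=> w1 r0; rewrite -sqnormB_scale// /shrink_est sqnormZ w1 mulr1 scalerA.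
by congr (sqnorm (_ *: _ - _)); field; rewrite gt_eqF.
Qed.

Lemma cmeas_loss (phi : R -> R) (theta : V) : measurable_fun setT phi ->
  cmeas R q.+3 (fun x => (sqnorm (shrink_est phi x - theta))%:E).
Proof.
move=> mphi d T u c mu0 mc; apply/measurable_EFinP; apply: measurable_sqnorm => i.
have ms := measurable_sqnorm R q.+3 _ _ c mc.
rewrite (_ : (fun t => _) = (fun t => (1 - phi (sqnorm (c t)) / sqnorm (c t)) * c t 0 i - theta 0 i)); last first.
  by apply/funext => t; rewrite !mxE.
apply: measurable_funB => //; apply: measurable_funM => //.
apply: measurable_funB => //; apply: measurable_funM; last exact: measurable_funV.
exact: (measurableT_comp mphi).
Qed.

Let phi : R -> R := phi_of q.+3 Phi C.

Let aE : q.+3%:R - 2 = q.+1%:R :> R.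
Proof. by rewrite -[q.+3]addn2 natrD addrK. Qed.

Let phiE r : phi (r ^+ 2) = q.+1%:R - gain r.
Proof. by rewrite /phi /phi_of aE. Qed.

Let measurable_phi : measurable_fun setT phi.
Proof.
apply: measurable_funB => //; apply: measurable_funV; apply: measurable_funD => //.
exact: measurable_cumul.
Qed.

Let lphi (theta x : V) := sqnorm (shrink_est phi x - theta).
Let ljs (theta x : V) := sqnorm (js_est x - theta).

(** The expectation at [theta] of h(|X|)/|X|^2, up to the same factor as in [ray_mass]. *)
Definition surplus (h : R -> R) (theta : V) : \bar R :=
  (\int[mu]_(r in `]0%R, +oo[) ((r ^+ q * tilt R 0 r * h r)%:E * mass R q.+3 theta r))%E.

(** [ray_identity] holds on every ray and is integrated against [kap]. It is kept additive because
    these terms may be infinite. *)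
Lemma ray_mass_identity theta :
  (ray_mass R q.+3 theta (lphi theta) + surplus pos_part theta =
   ray_mass R q.+3 theta (ljs theta) + surplus neg_part theta)%E.
Proof.
have mjs : measurable_fun setT (fun _ : R => q.+3%:R - 2 : R) by [].
have mphi' := cmeas_loss _ theta measurable_phi.
have mjs' := cmeas_loss _ theta mjs.
rewrite /surplus -(leb_radial _ _ _ _ _ measurable_pos_part pos_part_ge0).
rewrite -(leb_radial _ _ _ _ _ measurable_neg_part neg_part_ge0).
have t0 n (x : V) (h : R -> R) r : (forall r, 0 <= h r) -> (`]0%R, +oo[%classic : set R) r ->
    (0 <= (r ^+ n * tilt R (dot R q.+3 theta (dir R q.+3 x)) r * h r)%:E)%E.
  move=> h0 /=; rewrite in_itv/= andbT => r0.
  by rewrite lee_fin mulr_ge0// mulr_ge0 ?(ltW (tilt_gt0 _ _ _))// exprn_ge0// ltW.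
have mrad (h : R -> R) : measurable_fun setT h -> (forall r, 0 <= h r) ->
    cmeas R q.+3 (fun x => (kap R q.+3 x)%:E * \int[mu]_(r in `]0%R, +oo[)
      (r ^+ q * tilt R (dot R q.+3 theta (dir R q.+3 x)) r * h r)%:E)%E.
  move=> mh h0; apply: cmeas_mul; first exact: cmeas_kap.
  apply: jmeas_integral => //; last by move=> r x; exact: t0.
  move=> d T u c mu0 mc; apply/measurable_EFinP; apply: measurable_funM; last first.
    exact: (measurableT_comp mh).
  apply: measurable_funM; first exact: measurable_funX.
  apply: measurableT_comp => //; apply: measurable_funB.
    apply: measurable_funM => //; apply: measurable_dot; exact: measurable_dir.
  by apply: measurable_funM => //; exact: measurable_funX.
have mray (l : V -> R) : cmeas R q.+3 (fun x => (l x)%:E) -> (forall x, 0 <= l x) ->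
    cmeas R q.+3 (fun x => (kap R q.+3 x)%:E * \int[mu]_(r in `]0%R, +oo[)
      (r ^+ q.+2 * tilt R (dot R q.+3 theta (dir R q.+3 x)) r * l (r *: dir R q.+3 x))%:E)%E.
  move=> ml l0; apply: cmeas_mul; first exact: cmeas_kap.
  apply: jmeas_integral => //; last by move=> r x; exact: ray_ge0.
  exact: jmeas_ray.
have kI (x : V) (f : R -> \bar R) : (forall r, (`]0%R, +oo[%classic : set R) r -> 0 <= f r)%E ->
    (0 <= (kap R q.+3 x)%:E * \int[mu]_(r in `]0%R, +oo[) f r)%E.
  by move=> f0; rewrite mule_ge0 ?lee_fin ?kap_ge0//; exact: integral_ge0.
rewrite /ray_mass /leb -!leb_iterD.
- congr (leb_iter _ _ _ _ _); apply/funext => x.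
  have [->|x0] := eqVneq x 0; first by rewrite kap0 !mul0e.
  rewrite -!ge0_muleDr; try by apply: integral_ge0 => r;
    first [exact: t0 _ _ _ _ pos_part_ge0 | exact: t0 _ _ _ _ neg_part_ge0 |
           by apply: ray_ge0 => y; exact: sqnorm_ge0].
  congr (_ * _)%E.
  have w1 := sqnorm_dir R q.+3 x x0.
  have mc i : measurable_fun setT (fun r : R => (r *: dir R q.+3 x) 0 i).
    by apply: measurable_scale_coord.
  apply: ray_identity.
  - by apply/measurable_EFinP; apply: (cmeas_measurable _ _ _ _ _ _ mphi' mc).
  - by apply/measurable_EFinP; apply: (cmeas_measurable _ _ _ _ _ _ mjs' mc).
  - by move=> r; exact: sqnorm_ge0.
  - by move=> r; exact: sqnorm_ge0.
  - by move=> r r0; rewrite /lphi loss_on_ray// phiE.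
  - by move=> r r0; rewrite /ljs /js_est loss_on_ray// aE.
- by apply: mray => // x; exact: sqnorm_ge0.
- by apply: mrad; (exact: measurable_neg_part || exact: neg_part_ge0).
- by move=> x; apply: kI => r; apply: ray_ge0 => y; exact: sqnorm_ge0.
- by move=> x; apply: kI => r; apply: t0; exact: neg_part_ge0.
- by apply: mray => // x; exact: sqnorm_ge0.
- by apply: mrad; (exact: measurable_pos_part || exact: pos_part_ge0).
- by move=> x; apply: kI => r; apply: ray_ge0 => y; exact: sqnorm_ge0.
- by move=> x; apply: kI => r; apply: t0; exact: pos_part_ge0.
Qed.

(** * Finiteness, and propagation of the sign from 0 to theta *)

Let N0 := leb R q.+3 (fun x => (kap R q.+3 x)%:E).
Local Notation D := (`]0%R, +oo[%classic : set R).

Let N0_ge0 : (0 <= N0)%E.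
Proof. by rewrite /N0 -(mass0l R q.+3 0) mass_ge0. Qed.

Let N0_fin : N0 \is a fin_num.
Proof. by rewrite ge0_fin_numE// leb_kap_fin. Qed.

Let mt n b (h : R -> R) : measurable_fun setT h ->
  measurable_fun D (fun r : R => (r ^+ n * tilt R b r * h r)%:E).
Proof.
move=> mh; apply/measurable_EFinP; apply: measurable_funTS; apply: measurable_funM => //.
exact: measurable_monomial_tilt.
Qed.

Let t0 n b (h : R -> R) r : (forall r, 0 <= h r) -> D r ->
  (0 <= (r ^+ n * tilt R b r * h r)%:E)%E.
Proof.
move=> h0; rewrite /= in_itv/= andbT => r0.
by rewrite lee_fin mulr_ge0// mulr_ge0 ?(ltW (tilt_gt0 _ _ _))// exprn_ge0// ltW.
Qed.

Let mmass theta : measurable_fun D (mass R q.+3 theta).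
Proof. by apply: measurable_funTS; exact: measurable_mass. Qed.

Let mprod theta n b (h : R -> R) : measurable_fun setT h ->
  measurable_fun D (fun r : R => (r ^+ n * tilt R b r * h r)%:E * mass R q.+3 theta r)%E.
Proof. by move=> mh; apply: emeasurable_funM; [exact: mt|exact: mmass]. Qed.

(** [neg_part] is bounded and [mass] grows at most like exp(r B), which merely changes the Gaussian
    weight into one tilted by [B]. *)
Lemma surplus_neg_fin theta : (surplus neg_part theta < +oo)%E.
Proof.
set B := \sum_i `|theta 0 i|.
have K0 : (0 <= (C^-1 ^+ 2)%:E * N0)%E by rewrite mule_ge0// lee_fin sqr_ge0.
apply: (@le_lt_trans _ _ (\int[mu]_(r in D) ((r ^+ q * tilt R B r)%:E * ((C^-1 ^+ 2)%:E * N0)))%E).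
  have mB : measurable_fun D (fun r : R => (r ^+ q * tilt R B r)%:E).
    by apply/measurable_EFinP; apply: measurable_funTS; exact: measurable_monomial_tilt.
  apply: ge0_le_integral => //.
  - by move=> r Dr; rewrite mule_ge0 ?mass_ge0//; exact: t0 _ _ _ _ neg_part_ge0 Dr.
  - exact: (mprod _ _ _ _ measurable_neg_part).
  - exact: emeasurable_funM.
  - move=> r Dr; have := Dr; rewrite /= in_itv/= andbT => r0.
    have h := mass_le R q.+3 theta r (ltW r0).
    apply: le_trans (lee_wpmul2l (t0 _ _ _ _ neg_part_ge0 Dr) h) _.
    rewrite !muleA lee_wpmul2r// -!EFinM lee_fin.
    have -> : tilt R B r = tilt R 0 r * expR (r * B).
      by rewrite /tilt mulr0 sub0r -expRD addrC.
    rewrite -/B; have := neg_part_le r.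
    have : 0 <= r ^+ q * tilt R 0 r * expR (r * B).
      by rewrite !mulr_ge0 ?expR_ge0 ?(ltW (tilt_gt0 _ _ _))// exprn_ge0// ltW.
    move=> h1 h2; have := ler_wpM2l h1 h2; lra.
rewrite ge0_integralZr//.
- rewrite lte_mul_pinfty//.
  + by apply: integral_ge0 => r Dr; have := t0 q B (fun=> 1) r (fun=> ler01) Dr; rewrite mulr1.
  + by rewrite ge0_fin_numE ?monomial_tilt_int//; apply: integral_ge0 => r Dr;
      have := t0 q B (fun=> 1) r (fun=> ler01) Dr; rewrite mulr1.
  + by rewrite -ge0_fin_numE// fin_numM.
- by apply/measurable_EFinP; apply: measurable_funTS; exact: measurable_monomial_tilt.
- by move=> r Dr; have := t0 q B (fun=> 1) r (fun=> ler01) Dr; rewrite mulr1.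
Qed.

(** At theta = 0 the James-Stein loss (r - (p-2)/r)^2 times r^(p-1) is r^(p-3) (r^2 - (p-2))^2, so
    the singularity at 0 is harmless for p >= 3. *)
Lemma ray_mass_js0_fin : (ray_mass R q.+3 0 (ljs 0) < +oo)%E.
Proof.
pose h (r : R) := (r - q.+1%:R / r) ^+ 2.
have mh : measurable_fun setT h.
  apply: measurable_funX; apply: measurable_funB => //.
  by apply: measurable_funM => //; exact: measurable_inv.
have h0 r : 0 <= h r by exact: sqr_ge0.
have -> : ray_mass R q.+3 0 (ljs 0) = leb R q.+3 (fun x => (kap R q.+3 x)%:E *
    \int[mu]_(r in `]0%R, +oo[) (r ^+ q.+2 * tilt R (dot R q.+3 0 (dir R q.+3 x)) r * h r)%:E)%E.
  congr (leb _ _ _); apply/funext => x.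
  have [->|x0] := eqVneq x 0; first by rewrite kap0 !mul0e.
  congr (_ * _)%E; apply: eq_integral => r; rewrite inE/= in_itv/= andbT => r0.
  congr (_ * _)%:E; rewrite /ljs /js_est loss_on_ray ?sqnorm_dir// aE dot0l.
  rewrite (_ : sqnorm (0 : V) = 0); last by rewrite /sqnorm big1// => i _; rewrite mxE expr0n.
  by rewrite mulr0 mul0r subr0 addr0.
rewrite leb_radial//; under eq_integral do rewrite mass0l -/N0.
rewrite ge0_integralZr//; [|exact: mt|by move=> r; exact: t0 _ _ _ _ h0].
(* From (y - z)^2 <= 2 z^2 + 2 y^2 with y = r^2 and z = q + 1. *)
pose g r := (q.+1%:R ^+ 2 *+ 2 * (r ^+ q * tilt R 0 r) + 2 * (r ^+ q.+4 * tilt R 0 r)) : R.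
have mg n : measurable_fun D (fun r : R => (r ^+ n * tilt R 0 r)%:E).
  by apply/measurable_EFinP; apply: measurable_funTS; exact: measurable_monomial_tilt.
have g0 n r : D r -> (0 <= (r ^+ n * tilt R 0 r)%:E)%E.
  by move=> Dr; have := t0 n 0 (fun=> 1) r (fun=> ler01) Dr; rewrite mulr1.
have c0 : (0 : R) <= q.+1%:R ^+ 2 *+ 2 by rewrite mulrn_wge0// sqr_ge0.
have gI : (\int[mu]_(r in D) (g r)%:E < +oo)%E.
  have gE r : ((g r)%:E = (q.+1%:R ^+ 2 *+ 2)%:E * (r ^+ q * tilt R 0 r)%:E +
    2%:E * (r ^+ q.+4 * tilt R 0 r)%:E)%E by [].
  under eq_integral do rewrite gE.
  rewrite ge0_integralD//; last 4 first.
  - by move=> r Dr; rewrite mule_ge0 ?g0// lee_fin.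
  - by apply: emeasurable_funM => //; exact: mg.
  - by move=> r Dr; rewrite mule_ge0 ?g0// lee_fin.
  - by apply: emeasurable_funM => //; exact: mg.
  rewrite !ge0_integralZl//; [|exact: mg|exact: g0|exact: mg|exact: g0].
  by rewrite lte_add_pinfty// lte_mul_pinfty// ?lee_fin//; exact: monomial_tilt_int.
have hI : (\int[mu]_(r in D) (r ^+ q.+2 * tilt R 0 r * h r)%:E < +oo)%E.
  apply: le_lt_trans gI; apply: ge0_le_integral => //.
  - by move=> r; exact: t0 _ _ _ _ h0.
  - exact: mt.
  - apply/measurable_EFinP; apply: measurable_funTS.
    by apply: measurable_funD; apply: measurable_funM => //; exact: measurable_monomial_tilt.
  move=> r; rewrite /= in_itv/= andbT => r0; rewrite lee_fin /g /h.
  have -> : r ^+ q.+2 * tilt R 0 r * (r - q.+1%:R / r) ^+ 2 =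
      r ^+ q * tilt R 0 r * (r ^+ 2 - q.+1%:R) ^+ 2.
    by rewrite !exprS; field; rewrite gt_eqF.
  have : 0 <= r ^+ q * tilt R 0 r.
    by rewrite mulr_ge0 ?(ltW (tilt_gt0 _ _ _))// exprn_ge0// ltW.
  have -> : r ^+ q.+4 * tilt R 0 r = r ^+ q * tilt R 0 r * (r ^+ 2) ^+ 2 by rewrite !exprS; ring.
  move: (r ^+ q * tilt R 0 r) => t tt0.
  have := mulr_ge0 tt0 (sqr_ge0 (r ^+ 2 + q.+1%:R)); rewrite -mulr_natl.
  move: (r ^+ 2) => y; move: (q.+1%:R) => z; rewrite !expr2; lra.
by rewrite lte_mul_pinfty// ?ge0_fin_numE// ?integral_ge0//;
  [move=> r; exact: t0 _ _ _ _ h0|move=> r; exact: t0 _ _ _ _ h0|rewrite -ge0_fin_numE].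
Qed.

(** If the sign changes at r0, then [mass] is at most its value at r0 where [neg_part] lives and at
    least that value where [pos_part] lives. Freezing [mass] at r0 therefore enlarges the negative
    side, shrinks the positive one, and reduces to theta = 0. *)
Lemma surplus_le theta : (surplus neg_part 0 <= surplus pos_part 0)%E ->
  (surplus neg_part theta <= surplus pos_part theta)%E.
Proof.
move=> le0.
pose W (h : R -> R) := (\int[mu]_(r in D) (r ^+ q * tilt R 0 r * h r)%:E)%E.
have W_ge0 (h : R -> R) : (forall r, 0 <= h r) -> (0 <= W h)%E.
  by move=> h0; apply: integral_ge0 => r; exact: t0 _ _ _ _ h0.
have massK (h : R -> R) (m : \bar R) : measurable_fun setT h -> (forall r, 0 <= h r) -> (0 <= m)%E ->
    (\int[mu]_(r in D) ((r ^+ q * tilt R 0 r * h r)%:E * m) = W h * m)%E.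
  by move=> mh h0 m0; rewrite ge0_integralZr//; [exact: mt|move=> r; exact: t0 _ _ _ _ h0].
have surplus0 (h : R -> R) : measurable_fun setT h -> (forall r, 0 <= h r) -> surplus h 0 = (W h * N0)%E.
  by move=> mh h0; rewrite -massK//; apply: eq_integral => r _; rewrite mass0l.
have mP := measurable_pos_part; have mN := measurable_neg_part.
have P0 := pos_part_ge0; have NN0 := neg_part_ge0.
rewrite !surplus0// in le0.
(* If [N0] were 0, [mass] would vanish by [mass_le] and the claim would be trivial; otherwise [N0]
   cancels from the hypothesis. *)
have [N00|N00] := eqVneq N0 0%E.
  rewrite (_ : surplus neg_part theta = 0)%E.
    apply: integral_ge0 => r Dr; rewrite mule_ge0 ?mass_ge0//; exact: t0 _ _ _ _ P0 Dr.
  apply: integral0_eq => r; rewrite /= in_itv/= andbT => r0.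
  rewrite (_ : mass _ _ _ _ = 0)%E ?mule0//; apply/eqP; rewrite eq_le mass_ge0 andbT.
  by rewrite (le_trans (mass_le _ _ _ _ (ltW r0)))// -/N0 N00 mule0.
have {le0} leW : (W neg_part <= W pos_part)%E.
  by rewrite -(@lee_pmul2r _ N0)// lt_neqAle eq_sym N00 N0_ge0.
(* The radii with a negative sign; as Phi is nondecreasing they form an initial segment of the
   positive half line. *)
pose S : set R := [set r | 0 < r /\ 4 * Phi (r ^+ 2) < 1].
have PhiS r s : 0 < r -> r <= s -> S s -> S r.
  move=> r0 rs [s0 hs]; split => //; apply: le_lt_trans hs.
  rewrite ler_pM2l//; apply: Phi_nd; rewrite lerXn2r ?nnegrE//; lra.
have posS r : S r -> pos_part r = 0.
  by move=> [_ h]; rewrite /pos_part max_r ?mulr0//; lra.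
have negS r : 0 < r -> ~ S r -> neg_part r = 0.
  move=> r0 h; rewrite /neg_part max_r ?mulr0//.
  by rewrite subr_le0 leNgt; apply/negP => h'; exact: h.
have [ubS|ubS] := pselect (has_ubound S).
  (* The crossing point. For empty [S] the default [sup] is 0, which is right: no positive radius
     then has a negative sign. *)
  pose r0 := sup S.
  have S_le r : S r -> r <= r0 by move=> Sr; exact: ub_le_sup.
  have S_ge r : 0 < r -> ~ S r -> r0 <= r.
    move=> r_gt0 nSr; have [S0|S0] := pselect (S !=set0).
      apply: sup_le_ub => // s Ss; rewrite leNgt; apply/negP => rs.
      by apply: nSr; exact: PhiS (ltW rs) Ss.
    by rewrite /r0 (_ : S = set0) ?sup0 ?ltW//; apply/eqP/negPn/negP => /set0P.
  have r0_ge0 : 0 <= r0.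
    have [[s Ss]|S0] := pselect (S !=set0).
      by case: (Ss) => s0 _; exact: le_trans (ltW s0) (S_le s Ss).
    by rewrite /r0 (_ : S = set0) ?sup0//; apply/eqP/negPn/negP => /set0P.
  have m0 := mass_ge0 R q.+3 theta r0.
  apply: (@le_trans _ _ (W neg_part * mass R q.+3 theta r0)%E).
    rewrite -massK//; apply: ge0_le_integral => //.
    - by move=> r Dr; rewrite mule_ge0 ?mass_ge0//; exact: t0 _ _ _ _ NN0 Dr.
    - exact: mprod.
    - by apply: emeasurable_funM => //; exact: mt.
    - move=> r Dr; have := Dr; rewrite /= in_itv/= andbT => r_gt0.
      have [Sr|nSr] := pselect (S r); last by rewrite (negS r)// mulr0 !mul0e.
      by rewrite lee_wpmul2l ?mass_nd ?S_le ?(ltW r_gt0)//; exact: t0 _ _ _ _ NN0 Dr.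
  apply: (@le_trans _ _ (W pos_part * mass R q.+3 theta r0)%E).
    by rewrite lee_wpmul2r.
  rewrite -massK//; apply: ge0_le_integral => //.
  - by move=> r Dr; rewrite mule_ge0 ?mass_ge0//; exact: t0 _ _ _ _ P0 Dr.
  - by apply: emeasurable_funM => //; exact: mt.
  - exact: mprod.
  - move=> r Dr; have := Dr; rewrite /= in_itv/= andbT => r_gt0.
    have [Sr|nSr] := pselect (S r); first by rewrite (posS r)// mulr0 !mul0e.
    by rewrite lee_wpmul2l ?mass_nd ?S_ge//; exact: t0 _ _ _ _ P0 Dr.
(* Without a crossing the sign is negative everywhere. Then [pos_part] vanishes on the half line,
   the hypothesis forces the integral of [neg_part] at 0 to vanish, and [neg_part] is null almost
   everywhere, hence at every theta. *)
have allS r : 0 < r -> S r.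
  move=> r_gt0; apply: contrapT => nSr; apply: ubS; exists r => s Ss.
  by rewrite leNgt; apply/negP => rs; apply: nSr; exact: PhiS (ltW rs) Ss.
have W0 : W neg_part = 0%E.
  apply/eqP; rewrite eq_le W_ge0// andbT (le_trans leW)// /W integral0_eq// => r.
  by rewrite /= in_itv/= andbT => r_gt0; rewrite (posS r (allS r r_gt0)) mulr0.
rewrite (_ : surplus neg_part theta = 0)%E.
  apply: integral_ge0 => r Dr; rewrite mule_ge0 ?mass_ge0//; exact: t0 _ _ _ _ P0 Dr.
have aeW : ae_eq mu D (fun r => (r ^+ q * tilt R 0 r * neg_part r)%:E) (cst 0%E).
  apply/ae_eq_integral_abs => //; first exact: mt.
  rewrite -[RHS]W0; apply: eq_integral => r; rewrite inE => Dr.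
  by rewrite gee0_abs//; exact: t0 _ _ _ _ NN0 Dr.
rewrite /surplus (@ge0_ae_eq_integral _ _ _ mu D _ (cst 0%E))//.
- exact: integral0.
- exact: mprod.
- by move=> r Dr; rewrite mule_ge0 ?mass_ge0//; exact: t0 _ _ _ _ NN0 Dr.
- by apply: filterS aeW => r h Dr; rewrite h// mul0e.
Qed.

(** Two cancellations in [ray_mass_identity]: at 0 the finite James-Stein term turns the risk
    inequality into one between surpluses; at theta the finite negative surplus turns it back. *)
Lemma dominance_of_dominance_at0 :
  (risk (0 : V) (shrink_est phi) <= risk (0 : V) (@js_est R q.+3))%E ->
  forall theta : V, (risk theta (shrink_est phi) <= risk theta (@js_est R q.+3))%E.
Proof.
have mjs : measurable_fun setT (fun _ : R => q.+3%:R - 2 : R) by [].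
have K0 theta : 0 < normal_peak 1 ^+ q.+3 * expR (- (@sqnorm R q.+3 theta / 2)).
  by rewrite mulr_gt0 ?expR_gt0// exprn_gt0// normal_peak_gt0// oner_neq0.
have riskE (psi : R -> R) theta : measurable_fun setT psi -> risk theta (shrink_est psi) =
    ((normal_peak 1 ^+ q.+3 * expR (- (@sqnorm R q.+3 theta / 2)))%:E *
     ray_mass R q.+3 theta (fun x => sqnorm (shrink_est psi x - theta)%R))%E.
  move=> mpsi; rewrite /risk gauss_expect_polar//; first exact: cmeas_loss.
  by move=> x; exact: sqnorm_ge0.
have riskle theta : (risk theta (shrink_est phi) <= risk theta (@js_est R q.+3))%E <->
    (ray_mass R q.+3 theta (lphi theta) <= ray_mass R q.+3 theta (ljs theta))%E.
  by rewrite /js_est !riskE// lee_pmul2l// lte_fin.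
move=> /riskle le0 theta; apply/riskle.
have rm_ge0 th l : (forall x, 0 <= l x) -> (0 <= ray_mass R q.+3 th l)%E.
  move=> l0; apply: leb_iter_ge0 => x; rewrite mule_ge0 ?lee_fin ?kap_ge0//.
  by apply: integral_ge0 => r; exact: ray_ge0.
have surplus_ge0 (h : R -> R) th : (forall r, 0 <= h r) -> (0 <= surplus h th)%E.
  by move=> h0; apply: integral_ge0 => r Dr; rewrite mule_ge0 ?mass_ge0//; exact: t0 _ _ _ _ h0 Dr.
have finN th : surplus neg_part th \is a fin_num.
  by rewrite ge0_fin_numE ?surplus_neg_fin//; apply: surplus_ge0; exact: neg_part_ge0.
have finJ : ray_mass R q.+3 0 (ljs 0) \is a fin_num.
  by rewrite ge0_fin_numE ?ray_mass_js0_fin//; apply: rm_ge0 => x; exact: sqnorm_ge0.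
have /surplus_le h : (surplus neg_part 0 <= surplus pos_part 0)%E.
  rewrite -(@leeD2lE _ (ray_mass R q.+3 0 (ljs 0)))// -ray_mass_identity.
  by rewrite leeD2r.
have <- := leeD2rE (ray_mass R q.+3 theta (lphi theta)) (ray_mass R q.+3 theta (ljs theta)) (finN theta).
apply: (@le_trans _ _ (ray_mass R q.+3 theta (lphi theta) + surplus pos_part theta)%E).
  exact: leeD2l.
by rewrite (ray_mass_identity theta).
Qed.

End risk.

End profile.

Theorem theorem1 (R : realType) (p : nat) (Phi : R -> R) (C : R) :
  (3 <= p)%N ->
  (forall t, 0 < t -> 0 < Phi t) ->
  (forall s t, 0 < s -> s <= t -> Phi s <= Phi t) ->
  (forall w, 0 < w ->
     (\int[lebesgue_measure]_(t in `]0%R, w]%classic) (Phi t / t)%:E < +oo)%E) ->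
  (p%:R - 2)^-1 <= C ->
  (risk (0 : 'rV[R]_p) (@js_est R p) >= risk (0 : 'rV[R]_p) (@shrink_est R p (phi_of p Phi C)))%E ->
  forall theta : 'rV[R]_p,
    (risk theta (@shrink_est R p (phi_of p Phi C)) <= risk theta (@js_est R p))%E.
Proof.
move=> p_ge3 Phi_gt0 Phi_nd Phi_int C_ge.
have pE : p = (p - 3).+3 by rewrite -addn3 subnK.
(* With p = q + 3, both p - 2 and the exponent p - 3 are natural numbers without truncated
   subtraction. *)
move: (p - 3)%N pE C_ge => q -> {p p_ge3} C_ge.
have C_gt0 : 0 < C.
  apply: lt_le_trans C_ge; rewrite invr_gt0 subr_gt0 ltr_nat//.
(* Extension by 0 makes Phi nonnegative and nondecreasing on the whole line; phi sees only values at
   t > 0 and is unchanged. *)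
pose Psi t := if 0 < t then Phi t else 0.
have PsiE t : 0 < t -> Psi t = Phi t by rewrite /Psi => ->.
have -> : phi_of q.+3 Phi C = phi_of q.+3 Psi C.
  apply/funext => w; congr (_ - (fine _ + _)^-1); apply: eq_integral => t.
  by rewrite inE/= in_itv/= => /andP[t0 _]; rewrite PsiE.
apply: dominance_of_dominance_at0 => //.
- move=> s t st; rewrite /Psi; case: (ltP 0 s) => s0.
    by rewrite (lt_le_trans s0 st) Phi_nd.
  by case: (ltP 0 t) => // t0; rewrite ltW// Phi_gt0.
- by move=> t; rewrite /Psi; case: (ltP 0 t) => // t0; rewrite ltW// Phi_gt0.
- move=> w w0; apply: le_lt_trans (Phi_int w w0).
  rewrite le_eqVlt; apply/orP; left; apply/eqP; apply: eq_integral => t.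
  by rewrite inE/= in_itv/= => /andP[t0 _]; rewrite PsiE.
Qed.
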